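(* Let $A$ be a finite dimensional $E$-tame algebra over an algebraically closed field $k$ and $\eta\in K_0(\operatorname{proj}A)$. (a) For general $f\in\operatorname{Hom}(\eta)$ we have $D_f=D_\eta$; in particular $D_\eta$ is a rational polyhedral cone. (b) $D_\eta$ depends only on the TF equivalence class of $\eta$: if $\theta\in K_0(\operatorname{proj}A)$ is TF equivalent to $\eta$, then $D_\theta=D_\eta$.
   Context: $\theta(X)=\langle\theta,[X]\rangle$ with $\langle[P(i)],[S(j)]\rangle=\delta_{ij}$; $\overline{\mathcal{T}}_\theta=\{X\mid\theta(X')\ge0$ for all factor modules $X'\}$, $\overline{\mathcal{F}}_\theta=\{X\mid\theta(X')\le0$ for all submodules $X'\}$; $\theta,\eta$ TF equivalent if both agree. For $\eta\in K_0(\operatorname{proj}A)$, $\eta=[P_0]-[P_1]$ without common summands, $\operatorname{Hom}(\eta)=\operatorname{Hom}_A(P_1,P_0)$ (irreducible variety; ''general'' = in a nonempty Zariski open dense subset), $P_f$ the 2-term complex of $f$. $A$ is $E$-tame if for every $\theta$ there are $f,g\in\operatorname{Hom}(\theta)$ with $\operatorname{Hom}_{\mathsf{K}^b(\operatorname{proj}A)}(P_f,P_g[1])=0$. For $f$, $\nu=D\operatorname{Hom}_A(-,A)$, $C_f=\operatorname{Cok}f$, $K_{\nu f}=\operatorname{Ker}\nu f$, $D_f=\{\theta\in K_0(\operatorname{proj}A)_\mathbb{R}\mid C_f\in\overline{\mathcal{T}}_\theta,\ K_{\nu f}\in\overline{\mathcal{F}}_\theta\}$, $D_\eta=\bigcup_{f\in\operatorname{Hom}(\eta)}D_f$.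 *)

(* Defs.v *)
From HB Require Import structures.
From mathcomp Require Import all_boot all_order all_algebra all_field.
From mathcomp Require Import reals.
From mathcomp Require mpoly.
Set Implicit Arguments. Unset Strict Implicit. Unset Printing Implicit Defensive.
Import Order.TTheory GRing.Theory Num.Theory.
Local Open Scope ring_scope.

Section Defs.
Variables (k : fieldType) (A : falgType k).

Definition ract_ok (M : vectType k) (act : A -> 'End(M)) : Prop :=
  [/\ act 1 = \1%VF,
      forall a b, act (a * b) = (act b \o act a)%VF &
      forall (c : k) a b, act (c *: a + b) = c *: act a + act b].

Definition stable (M : vectType k) (act : A -> 'End(M)) (W : {vspace M}) :=
  forall a, (act a @: W <= W)%VS.

(* e : 'I_n -> A is a complete irredundant set of primitive idempotents,
   i.e. P(i) := e i A (i : 'I_n) are representatives of the isoclasses of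
   indecomposable projective right A-modules (e A ~= e' A iff there are
   u in e A e', v in e' A e with u v = e, v u = e'). *)
Definition primitive_idem (x : A) :=
  [/\ x * x = x, x != 0 &
      forall y, y = x * y * x -> y * y = y -> y = 0 \/ y = x].

Definition iso_idem (x x' : A) :=
  exists u v, [/\ u = x * u * x', v = x' * v * x, u * v = x & v * u = x'].

Definition basic_idempotents n (e : 'I_n -> A) :=
  [/\ forall i, primitive_idem (e i),
      forall i j, iso_idem (e i) (e j) -> i = j &
      forall x, primitive_idem x -> exists i, iso_idem x (e i)].

Variables (n : nat) (e : 'I_n -> A).

(* theta(X) = <theta,[X]> = sum_i theta_i [X : S(i)]
            = sum_i theta_i dim_k Hom_A(P(i), X) = sum_i theta_i dim_k (X e_i),
   here for the subquotient X = V/U of an ambient module (U <= V stable). *)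
Definition tval (R : numDomainType) (theta : 'I_n -> R) (M : vectType k)
    (act : A -> 'End(M)) (U V : {vspace M}) : R :=
  \sum_i theta i * ((\dim (act (e i) @: V))%:R - (\dim (act (e i) @: U))%:R).

(* X = V/U in \overline{T}_theta : theta(X') >= 0 for all factor modules X'
   (the factor modules of V/U are the V/W with U <= W <= V stable). *)
Definition inT (R : numDomainType) (theta : 'I_n -> R) (M : vectType k)
    (act : A -> 'End(M)) (U V : {vspace M}) : Prop :=
  forall W : {vspace M}, stable act W -> (U <= W)%VS -> (W <= V)%VS ->
    0 <= tval theta act W V.

(* X = V/U in \overline{F}_theta : theta(X') <= 0 for all submodules X'
   (the submodules of V/U are the W/U with U <= W <= V stable). *)
Definition inF (R : numDomainType) (theta : 'I_n -> R) (M : vectType k)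
    (act : A -> 'End(M)) (U V : {vspace M}) : Prop :=
  forall W : {vspace M}, stable act W -> (U <= W)%VS -> (W <= V)%VS ->
    tval theta act U W <= 0.

Definition TF_equiv (R : numDomainType) (theta eta : 'I_n -> R) : Prop :=
  forall (M : vectType k) (act : A -> 'End(M)), ract_ok act ->
    (inT theta act 0%VS fullv <-> inT eta act 0%VS fullv) /\
    (inF theta act 0%VS fullv <-> inF eta act 0%VS fullv).

Definition pospart (z : int) : nat := if (0 <= z)%R then `|z|%N else 0%N.
Definition negpart (z : int) : nat := pospart (- z).

(* eta = [P_0] - [P_1] without common summands:
   P_0 = (+)_i P(i)^{eta_i^+}, P_1 = (+)_i P(i)^{eta_i^-};
   a direct sum (+)_{c} P(s_c) is encoded by the list s of its summands. *)
Definition summ0 (eta : 'I_n -> int) : seq 'I_n :=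
  flatten [seq nseq (pospart (eta i)) i | i <- enum 'I_n].
Definition summ1 (eta : 'I_n -> int) : seq 'I_n :=
  flatten [seq nseq (negpart (eta i)) i | i <- enum 'I_n].

Definition lab (s : seq 'I_n) (r : 'I_(size s)) : 'I_n := tnth (in_tuple s) r.
Arguments lab s r : clear implicits.

Definition mx (p q : nat) := {ffun 'I_p * 'I_q -> A}.

(* Hom_A(P(s), P(t)) = matrices y with y(r,c) in e_{t_r} A e_{s_c},
   acting on columns by left multiplication. *)
Definition homm (t s : seq 'I_n) (y : mx (size t) (size s)) : Prop :=
  forall r c, y (r, c) = e (lab t r) * y (r, c) * e (lab s c).

Definition mxmul p q l (a : mx p q) (b : mx q l) : mx p l :=
  [ffun rc => \sum_j a (rc.1, j) * b (j, rc.2)].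

(* E-tame: for every theta there are f, g in Hom(theta) with
   Hom_{K^b(proj A)}(P_f, P_g[1]) = 0, i.e. every h : P_1 -> P_0 is
   null-homotopic: h = a f + g b with a : P_0 -> P_0, b : P_1 -> P_1. *)
Definition Etame : Prop :=
  forall theta : 'I_n -> int,
  exists f g : mx (size (summ0 theta)) (size (summ1 theta)),
    [/\ homm f, homm g &
        forall h, homm h ->
          exists (a : mx (size (summ0 theta)) (size (summ0 theta)))
                 (b : mx (size (summ1 theta)) (size (summ1 theta))),
            [/\ homm a, homm b & h = mxmul a f + mxmul g b]].

(* P(s) = (+)_c e_{s_c} A as a subspace of A^{size s} (column vectors) *)
Definition Pgen (s : seq 'I_n) : seq {ffun 'I_(size s) -> A} :=
  [seq [ffun c' => if c' == c then e (lab s c) * b else 0]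
  | c <- enum 'I_(size s), b : A <- vbasis (fullv : {vspace A})].
Definition Pspace (s : seq 'I_n) : {vspace {ffun 'I_(size s) -> A}} :=
  <<Pgen s>>%VS.

Definition ractv (m : nat) (a : A) : 'End({ffun 'I_m -> A}) :=
  linfun (fun x : {ffun 'I_m -> A} => [ffun r => x r * a]).

Definition applyf (t s : seq 'I_n) (f : mx (size t) (size s))
    (x : {ffun 'I_(size s) -> A}) : {ffun 'I_(size t) -> A} :=
  [ffun r => \sum_c f (r, c) * x c].

(* image of f : P_1 -> P_0, and C_f = Cok f = P_0 / Im f *)
Definition Imf (t s : seq 'I_n) (f : mx (size t) (size s)) :
  {vspace {ffun 'I_(size t) -> A}} := <<[seq applyf f x | x <- Pgen s]>>%VS.

(* Hom_A(P(s), A) = (+)_c A e_{s_c} (row vectors, left A-module) *)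
Definition Lgen (s : seq 'I_n) : seq {ffun 'I_(size s) -> A} :=
  [seq [ffun c' => if c' == c then b * e (lab s c) else 0]
  | c <- enum 'I_(size s), b : A <- vbasis (fullv : {vspace A})].
Definition Lspace (s : seq 'I_n) : {vspace {ffun 'I_(size s) -> A}} :=
  <<Lgen s>>%VS.

(* Hom_A(f, A) : Hom_A(P_0, A) -> Hom_A(P_1, A), phi |-> phi o f *)
Definition homfA (t s : seq 'I_n) (f : mx (size t) (size s))
   : 'Hom(subvs_of (Lspace t), subvs_of (Lspace s)) :=
  linfun (fun x : subvs_of (Lspace t) =>
    vsproj (Lspace s) [ffun c => \sum_r vsval x r * f (r, c)]).

(* nu P(s) = D Hom_A(P(s), A), with its right A-action (psi a)(x) = psi(a x) *)
Definition nuP (s : seq 'I_n) := 'Hom(subvs_of (Lspace s), k^o).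

Definition nuact (s : seq 'I_n) (a : A) : 'End(nuP s) :=
  linfun (fun psi : nuP s =>
    (psi \o linfun (fun x : subvs_of (Lspace s) =>
       vsproj (Lspace s) [ffun c => a * vsval x c]))%VF).

Definition nuf (t s : seq 'I_n) (f : mx (size t) (size s))
   : 'Hom(nuP s, nuP t) :=
  linfun (fun psi : nuP s => (psi \o homfA f)%VF).

Definition Knuf (t s : seq 'I_n) (f : mx (size t) (size s)) : {vspace nuP s} :=
  lker (nuf f).

Definition inDf (R : numDomainType) (t s : seq 'I_n) (f : mx (size t) (size s))
    (theta : 'I_n -> R) : Prop :=
  inT theta (@ractv (size t)) (Imf f) (Pspace t) /\
  inF theta (@nuact s) 0%VS (Knuf f).

Definition inDeta (R : numDomainType) (eta : 'I_n -> int) (theta : 'I_n -> R) : Prop :=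
  exists f : mx (size (summ0 eta)) (size (summ1 eta)), homm f /\ inDf f theta.

End Defs.

(* A property P holds for general y in the (irreducible) linear variety
   H of the k-space V if it holds on a nonempty Zariski-open subset of H;
   equivalently on a nonempty basic open subset {p <> 0} of H, p a
   polynomial in the coordinates w.r.t. a basis of V. *)
Definition general (k : fieldType) (V : vectType k) (H : V -> Prop) (P : V -> Prop) : Prop :=
  exists p : mpoly.mpoly (\dim (fullv : {vspace V})) k,
    (exists y, H y /\ mpoly.meval (fun i => coord (vbasis fullv) i y) p != 0) /\
    forall y, H y -> mpoly.meval (fun i => coord (vbasis fullv) i y) p != 0 -> P y.

Definition rational_polyhedral_cone (R : numDomainType) (n : nat) (D : ('I_n -> R) -> Prop) : Prop :=
  exists cs : seq ('I_n -> int),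
    forall theta, D theta <-> all (fun c => 0 <= \sum_i (c i)%:~R * theta i) cs.

(* Main.v *)
Require Import Defs.
From HB Require Import structures.
From mathcomp Require Import all_boot all_order all_algebra all_field.
From mathcomp Require Import boolp reals mpoly zify.
Set Implicit Arguments. Unset Strict Implicit. Unset Printing Implicit Defensive.
Import Order.TTheory GRing.Theory Num.Theory passmx Defs.
Local Open Scope ring_scope.

(** Write E(f, g) = Hom(P_f, P_g[1]).  For g in Hom(theta) and a module X,
    theta(X) = dim Hom(C_g, X) - dim Hom(X, K_{nu g}), so Hom(X, K_{nu g}) = 0
    implies that X lies in T_theta, since this vanishing passes to factor modules.
    If A is E-tame the converse holds for some g: pick f, g in Hom(theta) with
    E(f, g) = 0.  A nonzero map X -> K_{nu f} with X in T_theta has an image Y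
    with theta(Y) = 0 and Hom(C_g, Y) = 0, hence Hom(Y, K_{nu g}) = 0; its kernel
    is again in T_theta, so induction on dim X and the irreducibility of
    Hom(theta) apply.  The dual statement holds for F_theta.

    As E(f, g) = 0 means Hom(C_g, K_{nu f}) = 0, an integral theta is in D_h with
    h in Hom(eta) if and only if E(g, h) = E(h, g) = 0 for some g in Hom(theta).
    This condition is open in h.  Conversely, for fixed g, such an h in Hom(eta)
    exists if and only if C_g is in T_eta and K_{nu g} is in F_eta, which depends
    only on the TF equivalence class of eta.  This gives (a) and (b) for
    integral points.  The cones D_f are cut out by integral inequalities from a
    fixed finite set, so a real point can be replaced by an integral one with the
    same signs. *)

(** * Subspaces and Zariski-open conditions *)

Section LinearAlgebra.
Variable k : fieldType.

(** Turns a linearly closed predicate, possibly with existential quantifiers inside, into a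
    [{vspace V}]. A subspace contained in [P] is enlarged by a missing vector until none is left;
    the induction is on the codimension. *)
Lemma subspace_ex (V : vectType k) (P : V -> Prop) :
  P 0 -> (forall c x y, P x -> P y -> P (c *: x + y)) ->
  exists W : {vspace V}, forall x, x \in W <-> P x.
Proof.
move=> P0 PD.
suff H m : forall W : {vspace V}, (\dim {:V} - \dim W <= m)%N ->
    (forall x, x \in W -> P x) ->
    exists W : {vspace V}, forall x, x \in W <-> P x.
  by apply: (H (\dim {:V}) 0%VS (leq_subr _ _)) => x; rewrite memv0 => /eqP->.
elim: m => [|m IHm] W dW WP.
  exists W => x; split; first exact: WP.
  move=> _; have /eqP -> : W == fullv; last exact: memvf.
  by rewrite eqEdim subvf /= -subn_eq0 -leqn0.
have [allW|/existsNP[x /not_implyP[Px /negP xW]]] := pselect (forall x, P x -> x \in W).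
  by exists W => x; split; [exact: WP|exact: allW].
apply: (IHm (<[x]> + W)%VS).
  have : (\dim W < \dim (<[x]> + W))%N.
    rewrite ltn_neqAle dimvS ?addvSr // andbT; apply: contra xW => /eqP dE.
    have /eqP -> : W == (<[x]> + W)%VS by rewrite eqEdim addvSr dE leqnn.
    by rewrite memvE addvSl.
  have := dimvS (subvf (<[x]> + W)%VS).
  by move: dW; lia.
by move=> z /memv_addP[u /vlineP[c ->] [w wW ->]]; apply: PD => //; exact: WP.
Qed.

(** The projection [\1 - projv U] kills [U] but not [v]; [phi] is a coordinate of it that is nonzero
    at [v]. *)
Lemma separating_form (V : vectType k) (U : {vspace V}) (v : V) : v \notin U ->
  exists2 phi : 'Hom(V, k^o), {in U, forall u, phi u = 0} & phi v != 0.
Proof.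
move=> vU.
have w0 : v - projv U v != 0.
  by apply: contra vU; rewrite subr_eq0 => /eqP ->; exact: memv_proj.
have [i ci] : exists i, coord (vbasis fullv) i (v - projv U v) != 0.
  apply: contrapT => /forallNP ci; move/negP: w0; apply; apply/eqP.
  rewrite (coord_vbasis (memvf (v - projv U v))) big1 // => i _.
  by have /negP := ci i; rewrite negbK => /eqP ->; rewrite scale0r.
pose c := linfun (coord (vbasis (fullv : {vspace V})) i : V -> k^o).
exists (c \o (\1 - projv U))%VF => [u uU|].
  by rewrite comp_lfunE add_lfunE id_lfunE opp_lfunE projv_id // subrr linear0.
by rewrite comp_lfunE add_lfunE id_lfunE opp_lfunE lfunE.
Qed.

(** Rank-nullity for the map from [U] to the quotient of [Y] by [W]. *)
Lemma dim_img_preim (X Y : vectType k) (f : 'Hom(X, Y)) (U : {vspace X})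
    (W : {vspace Y}) :
  (\dim (f @: U + W) + \dim (U :&: f @^-1: W) = \dim U + \dim W)%N.
Proof.
have H1 := limg_ker_dim f U.
have H2 := limg_ker_dim f (U :&: f @^-1: W).
have H3 := dimv_sum_cap (f @: U) W.
have E1 : (U :&: f @^-1: W :&: lker f = U :&: lker f)%VS.
  apply/vspaceP => x; rewrite !memv_cap -memv_preim memv_ker.
  by case: eqP => [->|_]; rewrite ?mem0v ?andbT ?andbF.
have E2 : (f @: (U :&: f @^-1: W) = (f @: U) :&: W)%VS.
  apply/vspaceP => y; rewrite memv_cap; apply/memv_imgP/andP.
    by case=> x; rewrite memv_cap -memv_preim => /andP[xU fx] ->; split => //; exact: memv_img.
  by case=> /memv_imgP[x xU ->] fx; exists x; rewrite // memv_cap -memv_preim xU.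
rewrite E1 E2 in H2.
by move: H1 H2 H3; lia.
Qed.

(** * Polynomial functions in the coordinates of a vector space *)

Section PolynomialFunctions.
Variable V : vectType k.

Definition polyfun (F : V -> k) :=
  exists p : {mpoly k[\dim (fullv : {vspace V})]},
    forall y, p.@[fun i => coord (vbasis fullv) i y] = F y.

Lemma polyfun_ext F G : F =1 G -> polyfun F -> polyfun G.
Proof. by move=> FG [p pF]; exists p => y; rewrite pF. Qed.

Lemma polyfun_const c : polyfun (fun=> c).
Proof. by exists c%:MP => y; rewrite mevalC. Qed.

Lemma polyfunD F G : polyfun F -> polyfun G -> polyfun (fun y => F y + G y).
Proof. by move=> [p pF] [q qG]; exists (p + q) => y; rewrite mevalD pF qG. Qed.

Lemma polyfunM F G : polyfun F -> polyfun G -> polyfun (fun y => F y * G y).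
Proof. by move=> [p pF] [q qG]; exists (p * q) => y; rewrite mevalM pF qG. Qed.

Lemma polyfun_sum (I : Type) (r : seq I) (F : I -> V -> k) :
  (forall i, polyfun (F i)) -> polyfun (fun y => \sum_(i <- r) F i y).
Proof.
move=> pF; elim: r => [|i r IHr].
  by apply: polyfun_ext (polyfun_const 0) => y; rewrite big_nil.
by apply: polyfun_ext (polyfunD (pF i) IHr) => y; rewrite big_cons.
Qed.

Lemma polyfun_prod (I : Type) (r : seq I) (F : I -> V -> k) :
  (forall i, polyfun (F i)) -> polyfun (fun y => \prod_(i <- r) F i y).
Proof.
move=> pF; elim: r => [|i r IHr].
  by apply: polyfun_ext (polyfun_const 1) => y; rewrite big_nil.
by apply: polyfun_ext (polyfunM (pF i) IHr) => y; rewrite big_cons.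
Qed.

Lemma polyfun_linear (F : V -> k) :
  (forall c x y, F (c *: x + y) = c * F x + F y) -> polyfun F.
Proof.
move=> linF.
have F0 : F 0 = 0.
  have := linF 1 0 0; rewrite scale1r addr0 mul1r => /esym/eqP.
  by rewrite -subr_eq0 addrK => /eqP.
apply: (@polyfun_ext
  (fun y => \sum_i coord (vbasis fullv) i y * F (vbasis fullv)`_i)).
  move=> y; rewrite [in RHS](coord_vbasis (memvf y)).
  rewrite (big_morph F (id1 := 0) (op1 := +%R)) //.
    by apply: eq_bigr => i _; rewrite -[in RHS](addr0 (_ *: _)) linF F0 addr0.
  by move=> x z; rewrite -{1}[x]scale1r linF mul1r.
apply: polyfun_sum => i; apply: polyfunM (polyfun_const _).
by exists 'X_i => y; rewrite mevalXU.
Qed.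

Lemma polyfun_det m (N : V -> 'M[k]_m) :
  (forall i j, polyfun (fun y => N y i j)) -> polyfun (fun y => \det (N y)).
Proof.
move=> pN; rewrite /determinant; apply: polyfun_sum => s.
by apply: polyfunM (polyfun_const _) _; apply: polyfun_prod.
Qed.

(** Restriction to the line with [x] at parameter 0 and [y] at parameter 1. *)
Lemma polyfun_line F (x y : V) : polyfun F ->
  exists q : {poly k}, forall s, q.[s] = F (s *: (y - x) + x).
Proof.
move=> [p pF]; pose a i := coord (vbasis (fullv : {vspace V})) i x.
pose b i := coord (vbasis (fullv : {vspace V})) i (y - x).
exists (\sum_(m <- msupp p) p@_m *: \prod_i ((a i)%:P + (b i)%:P * 'X) ^+ m i).
move=> s; rewrite -pF mevalE horner_sum; apply: eq_bigr => m _.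
rewrite hornerZ horner_prod; congr (_ * _); apply: eq_bigr => i _.
by rewrite !hornerE linearP /= addrC mulrC.
Qed.

Variable H : V -> Prop.

Lemma general_intro F (P : V -> Prop) y0 : polyfun F -> H y0 -> F y0 != 0 ->
  (forall y, H y -> F y != 0 -> P y) -> general H P.
Proof.
move=> [p pF] Hy0 Fy0 FP; exists p; split; first by exists y0; rewrite pF.
by move=> y Hy; rewrite pF; exact: FP.
Qed.

Lemma general_ex P : general H P -> exists2 y, H y & P y.
Proof. by move=> [p [[y [Hy py]] pP]]; exists y => //; exact: pP. Qed.

Lemma general_sub (P Q : V -> Prop) : (forall y, H y -> P y -> Q y) ->
  general H P -> general H Q.
Proof.
by move=> PQ [p [ne pP]]; exists p; split=> // y Hy py; exact: PQ (pP _ Hy py).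
Qed.

End PolynomialFunctions.

(** Lower semicontinuity of the rank of the map from [A0] to B/B0 given by [G y]: a maximal
    independent family at [y0] stays independent where a suitable determinant is nonzero. *)
Lemma rank_general (V A B : vectType k) (H : V -> Prop) (G : V -> 'Hom(A, B))
    (A0 : {vspace A}) (B0 : {vspace B}) (y0 : V) :
  (forall c f g x, G (c *: f + g) x = c *: G f x + G g x) -> H y0 ->
  general H (fun y => (\dim (G y0 @: A0 + B0) <= \dim (G y @: A0 + B0))%N).
Proof.
move=> linG Hy0.
(* A complement in [A0] of the kernel at [y0]. The images of its basis, followed by a basis of [B0],
   form the independent family. *)
pose A1 := (A0 :\: (G y0 @^-1: B0))%VS.
pose Xs y := [tuple of map (G y) (vbasis A1)].
pose X y := [tuple of Xs y ++ vbasis B0].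
have spanX y : <<X y>>%VS = (G y @: A1 + B0)%VS.
  rewrite /= span_cat -limg_span !(span_basis (vbasisP _)) //.
have A1E : (G y0 @: A1 + B0 = G y0 @: A0 + B0)%VS.
  apply: subv_anti; rewrite !subv_add !addvSr !andbT; apply/andP; split.
    by apply: subv_trans (addvSl _ _); apply: limgS; exact: diffvSl.
  rewrite -[X in (G y0 @: X)%VS](addv_diff_cap A0 (G y0 @^-1: B0)) limgD subv_add addvSl /=.
  apply: subv_trans (addvSr _ _); apply/subvP => _ /memv_imgP[x + ->].
  by rewrite memv_cap -memv_preim => /andP[].
have dimE : \dim (G y0 @: A0 + B0) = (\dim A1 + \dim B0)%N.
  have := dim_img_preim (G y0) A0 B0; have := dimv_cap_compl A0 (G y0 @^-1: B0).
  by rewrite -/A1; lia.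
have sX y : size (X y) = (\dim A1 + \dim B0)%N by rewrite size_tuple.
pose b := vbasis (fullv : {vspace B}).
pose M y := \matrix_i rVof b (tnth (X y) i).
have mulM y v : v *m M y = rVof b (\sum_i v 0 i *: (X y)`_i).
  rewrite mulmx_sum_row linear_sum; apply: eq_bigr => i _.
  by rewrite rowK linearZ /= (tnth_nth 0).
have free0 : row_free (M y0).
  have /freeP fX : free (X y0) by rewrite /free spanX A1E dimE sX.
  apply: inj_row_free => v; rewrite mulM => /eqP.
  rewrite rVof_eq0 ?vbasisP // => /eqP /fX v0.
  by apply/rowP => i; rewrite v0 mxE.
(* The right inverse [N] is fixed, so [\det (M y *m N)] is polynomial in [y]. It equals 1 at [y0],
   and where it is nonzero the rows of [M y] are independent. *)
have [N MN] := row_freeP free0.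
apply: (@general_intro V H (fun y => \det (M y *m N)) _ y0) => //.
- apply: polyfun_det => i j.
  apply: (@polyfun_ext _ (fun y => \sum_l M y i l * N l j)).
    by move=> y; rewrite mxE.
  apply: polyfun_sum => l; apply: polyfunM (polyfun_const _ _).
  case: (ltnP i (\dim A1)) => iA.
    apply: polyfun_linear => c f g; rewrite !mxE !(tnth_nth 0) /=.
    rewrite !nth_cat !size_map !size_tuple iA !(nth_map 0) ?size_tuple //.
    by rewrite linG linearP.
  apply: (@polyfun_ext _ (fun=> M y0 i l)); last exact: polyfun_const.
  move=> y; rewrite !mxE !(tnth_nth 0) /=.
  by rewrite !nth_cat !size_map !size_tuple ltnNge iA.
- by rewrite MN det1 oner_eq0.
move=> y Hy detN.
have fy : free (X y).
  apply/freeP => a a0 i.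
  have : (\row_i a i) *m (M y *m N) = 0.
    rewrite mulmxA mulM (eq_bigr (fun i => a i *: (X y)`_i)).
      by rewrite a0 linear0 mul0mx.
    by move=> l _; rewrite mxE.
  move=> /(congr1 (mulmx^~ (invmx (M y *m N)))); rewrite mul0mx mulmxK; last first.
    by rewrite unitmxE unitfE.
  by move=> /rowP/(_ i); rewrite !mxE.
rewrite dimE -(sX y); move: fy; rewrite /free => /eqP <-.
by apply: dimvS; rewrite spanX addvS // limgS // diffvSl.
Qed.
End LinearAlgebra.

(** * Intersections of nonempty open sets over an algebraically closed field *)

Section ClosedField.
Variables (k : closedFieldType) (V : vectType k) (H : V -> Prop).
Hypothesis linH : forall c x y, H x -> H y -> H (c *: x + y).

(* On the line through a point of each open set, both defining polynomials
   become nonzero univariate polynomials. *)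
Lemma general_and (P Q : V -> Prop) :
  general H P -> general H Q -> general H (fun y => P y /\ Q y).
Proof.
move=> [p [[x [Hx px]] pP]] [q [[y [Hy qy]] qQ]].
have pp : polyfun (fun z => p.@[fun i => coord (vbasis fullv) i z]) by exists p.
have pq : polyfun (fun z => q.@[fun i => coord (vbasis fullv) i z]) by exists q.
have [p1 p1E] := polyfun_line x y pp.
have [q1 q1E] := polyfun_line x y pq.
have [] := closed_nonrootP (p1 * q1) _.
  rewrite mulf_neq0 //.
    apply: contra_neq px => p10.
    by have := p1E 0; rewrite p10 horner0 scale0r add0r => <-.
  apply: contra_neq qy => q10.
  by have := q1E 1; rewrite q10 horner0 scale1r subrK => <-.
move=> s; rewrite /root hornerM mulf_eq0 negb_or p1E q1E => /andP[ps qs].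
have Hs : H (s *: (y - x) + x).
  apply: linH (Hx); rewrite -scaleN1r addrC; exact: linH.
apply: (general_intro (polyfunM pp pq) Hs); first by rewrite mulf_neq0.
by move=> z Hz; rewrite mulf_eq0 negb_or => /andP[pz qz]; split; [exact: pP|exact: qQ].
Qed.

Lemma general_forall (I : finType) (P : I -> V -> Prop) :
  (exists y, H y) -> (forall i, general H (P i)) ->
  general H (fun y => forall i, P i y).
Proof.
move=> [y0 Hy0] gP.
suff : general H (fun y => forall i, i \in enum I -> P i y).
  by apply: general_sub => y _ Py i; apply: Py; rewrite mem_enum.
elim: (enum I) => [|i s IHs].
  apply: (general_intro (polyfun_const V 1) Hy0) => //; exact: oner_neq0.
apply: general_sub (general_and (gP i) IHs) => y _ [Pi Ps] j.
by rewrite inE => /orP[/eqP->//|]; exact: Ps.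
Qed.

End ClosedField.

(** * Modules and the maps Hom(f, X) *)

(** The module maps are [linfun] of bare functions, so their linearity enters as a hypothesis. *)
Lemma linfunE (k : fieldType) (U V : vectType k) (f : U -> V) :
  linear f -> linfun f =1 f.
Proof.
move=> linf; pose F : {linear U -> V} :=
  HB.pack f (GRing.isSemilinear.Build k U V _ f (GRing.semilinear_linear linf)).
exact: (lfunE F).
Qed.

Section Columns.
Variables (k : fieldType) (A : falgType k) (n : nat) (e : 'I_n -> A).
Hypothesis idem_e : forall i, e i * e i = e i.
Variables (M : vectType k) (act : A -> 'End(M)).
Hypothesis act_ok : ract_ok act.

Lemma act1E x : act 1 x = x.
Proof. by case: act_ok => -> _ _; rewrite id_lfunE. Qed.

Lemma actM a b x : act (a * b) x = act b (act a x).
Proof. by case: act_ok => _ -> _; rewrite comp_lfunE. Qed.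

Lemma actP c a b x : act (c *: a + b) x = c *: act a x + act b x.
Proof. by case: act_ok => _ _ ->; rewrite add_lfunE scale_lfunE. Qed.

Lemma act0 x : act 0 x = 0.
Proof. by have := actP (-1) 0 0 x; rewrite scaler0 addr0 scaleN1r addNr. Qed.

Lemma actD a b x : act (a + b) x = act a x + act b x.
Proof. by have := actP 1 a b x; rewrite !scale1r. Qed.

Lemma act_sum (I : Type) (r : seq I) (F : I -> A) x :
  act (\sum_(i <- r) F i) x = \sum_(i <- r) act (F i) x.
Proof.
elim: r => [|i r IHr]; first by rewrite !big_nil act0.
by rewrite !big_cons actD IHr.
Qed.

Lemma stableP (V : {vspace M}) :
  stable act V <-> forall a x, x \in V -> act a x \in V.
Proof.
split=> [sV a x xV|sV a]; first exact: (subvP (sV a)) _ (memv_img _ xV).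
by apply/subvP => _ /memv_imgP[x xV ->]; exact: sV.
Qed.

Lemma mem_act_idem i V x : stable act V ->
  (x \in act (e i) @: V)%VS = (x \in V) && (act (e i) x == x).
Proof.
move=> /stableP sV; apply/memv_imgP/andP.
  by case=> y yV ->; rewrite sV // -actM idem_e.
by case=> xV /eqP xE; exists x.
Qed.

Definition fdelta p (r : 'I_p) (x : M) : {ffun 'I_p -> M} :=
  [ffun r' => if r' == r then x else 0].

Lemma fdelta_linear p (r : 'I_p) : linear (fdelta r).
Proof.
by move=> c x y; apply/ffunP => j; rewrite !ffunE; case: eqP; rewrite ?scaler0 ?addr0.
Qed.

Lemma fdeltaE p (r : 'I_p) x : linfun (fdelta r) x = fdelta r x.
Proof. exact/linfunE/fdelta_linear. Qed.

Lemma sum_fdelta p (x : {ffun 'I_p -> M}) : x = \sum_r fdelta r (x r).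
Proof.
apply/ffunP => j; rewrite sum_ffunE (bigD1 j) //= ffunE eqxx big1 ?addr0 // => i ij.
by rewrite ffunE eq_sym (negPf ij).
Qed.

(* Hom_A(P(t), V), written as the tuples (x_r) with x_r in V e_{t_r}. *)
Definition homcol (t : seq 'I_n) (V : {vspace M}) : {vspace {ffun 'I_(size t) -> M}} :=
  (\sum_r (linfun (fdelta r) @: (act (e (lab (s:=t) r)) @: V)))%VS.

Lemma mem_homcolE t V x : (x \in homcol t V) <->
  (forall r, x r \in act (e (lab r)) @: V)%VS.
Proof.
split=> [/memv_sumP[y yP ->] r|xP].
  rewrite sum_ffunE; apply: memv_suml => i _.
  have /memv_imgP[z zV ->] := yP i isT; rewrite fdeltaE ffunE.
  by case: eqP => [->|_]; rewrite ?mem0v.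
rewrite [x]sum_fdelta; apply: memv_sumr => r _.
by rewrite -fdeltaE memv_img.
Qed.

Lemma mem_homcol t V x : stable act V -> (x \in homcol t V) <->
  (forall r, x r \in V /\ act (e (lab (s:=t) r)) (x r) = x r).
Proof.
move=> sV; rewrite mem_homcolE; split=> xP r.
  by have := xP r; rewrite mem_act_idem // => /andP[-> /eqP].
by have [xr xe] := xP r; rewrite mem_act_idem // xr xe eqxx.
Qed.

Lemma homcolS t U V : (U <= V)%VS -> (homcol t U <= homcol t V)%VS.
Proof.
move=> UV; apply/subvP => x /mem_homcolE xU; apply/mem_homcolE => r.
exact: (subvP (limgS _ UV)) _ (xU r).
Qed.

Lemma dim_homcol t V :
  \dim (homcol t V) = (\sum_(i <- t) \dim (act (e i) @: V))%N.
Proof.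
pose Us r := (linfun (fdelta r) @: (act (e (lab (s:=t) r)) @: V))%VS.
have /directvP/= : directv (\sum_r Us r).
  apply/directv_sum_independent => us usP us0 i _.
  have usE j r : us j r = if r == j then us j j else 0.
    have /memv_imgP[z _ ->] := usP j isT; rewrite fdeltaE !ffunE eqxx //.
  apply/ffunP => r; rewrite usE ffunE; case: eqP => // _.
  have /ffunP/(_ i) := us0; rewrite sum_ffunE ffunE (bigD1 i) //= big1 ?addr0 //.
  by move=> j ji; rewrite usE eq_sym (negPf ji).
rewrite /homcol => ->; rewrite [in RHS]big_tnth; apply: eq_bigr => r _.
apply: limg_dim_eq; apply/eqP; rewrite -subv0; apply/subvP => x.
rewrite memv_cap memv_ker fdeltaE => /andP[_ /eqP/ffunP/(_ r)].
by rewrite !ffunE eqxx memv0 => ->.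
Qed.

Lemma sum_summ (F : 'I_n -> nat) (m : 'I_n -> nat) :
  (\sum_(i <- flatten [seq nseq (m i) i | i <- enum 'I_n]) F i =
   \sum_i m i * F i)%N.
Proof.
rewrite big_flatten big_map big_enum; apply: eq_bigr => i _.
by elim: (m i) => [|j IHj]; rewrite ?big_nil //= big_cons IHj mulSn.
Qed.

(** Splitting each coefficient into positive and negative part gives, for X = V/U, theta(X) = dim
    Hom(P_0, X) - dim Hom(P_1, X). *)
Lemma tval_homcol (theta : 'I_n -> int) U V : tval e theta act U V =
  ((\dim (homcol (summ0 theta) V))%:Z - (\dim (homcol (summ0 theta) U))%:Z) -
  ((\dim (homcol (summ1 theta) V))%:Z - (\dim (homcol (summ1 theta) U))%:Z).
Proof.
rewrite !dim_homcol !sum_summ /tval.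
rewrite ![Posz (\sum_i _)%N](big_morph Posz PoszD (erefl (Posz 0))) -!sumrB.
apply: eq_bigr => i _; rewrite !PoszM -!mulrBr !natz -mulrBl; congr (_ * _).
rewrite /negpart /pospart; case: ifP; case: ifP; lia.
Qed.

Lemma tvalD (R : numDomainType) (theta : 'I_n -> R) U V W :
  tval e theta act U V + tval e theta act V W = tval e theta act U W.
Proof.
rewrite /tval -big_split /=; apply: eq_bigr => i _.
by rewrite -mulrDr addrC addrA subrK.
Qed.

(** Precomposition with the matrix [m], a homomorphism from a projective being recorded by the
    images of its generators. *)
Definition Gact p q (m : mx A p q) : 'Hom({ffun 'I_p -> M}, {ffun 'I_q -> M}) :=
  linfun (fun x : {ffun 'I_p -> M} => [ffun c => \sum_r act (m (r, c)) (x r)]).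

Lemma GactE p q (m : mx A p q) x c : Gact m x c = \sum_r act (m (r, c)) (x r).
Proof.
rewrite linfunE ?ffunE // => a u v; apply/ffunP => j; rewrite !ffunE.
rewrite scaler_sumr -big_split /=; apply: eq_bigr => r _.
by rewrite !ffunE linearP.
Qed.

Lemma Gact_linear p q c (f g : mx A p q) x :
  Gact (c *: f + g) x = c *: Gact f x + Gact g x.
Proof.
apply/ffunP => j; rewrite !ffunE !GactE scaler_sumr -big_split /=.
by apply: eq_bigr => r _; rewrite !ffunE actP.
Qed.

Lemma GactD p q (f g : mx A p q) x : Gact (f + g) x = Gact f x + Gact g x.
Proof. by rewrite -[f]scale1r Gact_linear !scale1r. Qed.

Lemma Gact_mul p q l (f : mx A p q) (g : mx A q l) x :
  Gact (mxmul f g) x = Gact g (Gact f x).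
Proof.
apply/ffunP => c; rewrite !GactE.
under eq_bigr do rewrite ffunE act_sum.
rewrite exchange_big; apply: eq_bigr => j _.
by rewrite GactE linear_sum; apply: eq_bigr => r _; rewrite actM.
Qed.

Lemma Gact_homcol t s (f : mx A (size t) (size s)) V x : stable act V ->
  homm e f -> x \in homcol t V -> Gact f x \in homcol s V.
Proof.
move=> sV hf /(mem_homcol _ sV) xV; apply/(mem_homcol _ sV) => c.
have sV' := (stableP V).1 sV.
rewrite GactE; split; first by apply: memv_suml => r _; apply: sV'; case: (xV r).
rewrite linear_sum; apply: eq_bigr => r _.
by rewrite /= -actM hf -mulrA idem_e.
Qed.

(* For X = V/U: Hom_A(C_f, X) = 0, resp. Hom(P_f, X[1]) = D Hom_A(X, K_{nu f}) = 0. *)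
Definition hom0 t s (f : mx A (size t) (size s)) U V :=
  (homcol t V :&: Gact f @^-1: homcol s U <= homcol t U)%VS.
Definition ext0 t s (f : mx A (size t) (size s)) U V :=
  (homcol s V <= Gact f @: homcol t V + homcol s U)%VS.

Lemma hom0P t s (f : mx A (size t) (size s)) U V :
  reflect (forall x, x \in homcol t V -> Gact f x \in homcol s U -> x \in homcol t U)
    (hom0 f U V).
Proof.
apply: (iffP subvP) => [H x xV fx|H x].
  by apply: H; rewrite memv_cap xV -memv_preim.
by rewrite memv_cap -memv_preim => /andP[]; exact: H.
Qed.

(** * Vanishing of Hom and Ext as maximal rank conditions *)

Section Rank.
Variables (t s : seq 'I_n) (f : mx A (size t) (size s)) (U V : {vspace M}).
Hypotheses (hf : homm e f) (sU : stable act U) (sV : stable act V) (UV : (U <= V)%VS).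

Lemma rank_sub : (Gact f @: homcol t V + homcol s U <= homcol s V)%VS.
Proof.
rewrite subv_add homcolS // andbT; apply/subvP => _ /memv_imgP[x xV ->].
exact: Gact_homcol.
Qed.

Lemma preim_sup : (homcol t U <= homcol t V :&: Gact f @^-1: homcol s U)%VS.
Proof.
rewrite subv_cap homcolS //=; apply/subvP => x xU.
by rewrite -memv_preim Gact_homcol.
Qed.

(** [ext0] is surjectivity of Hom(P_0, V/U) -> Hom(P_1, V/U). The dimension form is the one to which
    [rank_general] applies. *)
Lemma ext0_dim : ext0 f U V =
  (\dim (homcol s V) <= \dim (Gact f @: homcol t V + homcol s U))%N.
Proof. by rewrite /ext0 (geq_leqif (dimv_leqif_sup rank_sub)). Qed.

Lemma rank_le :
  (\dim (Gact f @: homcol t V + homcol s U) <=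
   \dim (homcol t V) + \dim (homcol s U) - \dim (homcol t U))%N.
Proof.
have := dim_img_preim (Gact f) (homcol t V) (homcol s U).
have := dimvS preim_sup.
move: (\dim (_ :&: _)) (\dim (_ + _))
  (\dim (homcol _ V)) (\dim (homcol _ U)) (\dim (homcol _ U)).
by move=> a b c d c' H1 H2; clear -H1 H2; lia.
Qed.

Lemma hom0_dim : hom0 f U V =
  (\dim (homcol t V) + \dim (homcol s U) - \dim (homcol t U) <=
   \dim (Gact f @: homcol t V + homcol s U))%N.
Proof.
have := dim_img_preim (Gact f) (homcol t V) (homcol s U).
(* This inequality makes the natural-number subtraction in the statement exact. *)
have := dimvS (homcolS t UV).
rewrite /hom0 -(geq_leqif (dimv_leqif_sup preim_sup)).
move: (\dim (_ :&: _)) (\dim (_ + _))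
  (\dim (homcol t V)) (\dim (homcol t U)) (\dim (homcol s U)).
by move=> a b c d c' H1 H2; clear -H1 H2; apply/idP/idP; lia.
Qed.

End Rank.

Lemma ext0_quo t s (f : mx A (size t) (size s)) U W V :
  (U <= W)%VS -> ext0 f U V -> ext0 f W V.
Proof. by move=> UW; move=> H; apply: (subv_trans H); rewrite addvS ?homcolS. Qed.

Lemma hom0_sub t s (f : mx A (size t) (size s)) U W V :
  (W <= V)%VS -> hom0 f U V -> hom0 f U W.
Proof.
by move=> WV /hom0P H; apply/hom0P => x xW; apply: H; exact: (subvP (homcolS t WV)).
Qed.

(** Closure under the extension of V/W by W/U; this glues the two pieces in the inductions on the
    dimension. *)
Lemma ext0_ext t s (f : mx A (size t) (size s)) U W V : (W <= V)%VS ->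
  ext0 f U W -> ext0 f W V -> ext0 f U V.
Proof.
move=> WV H1 H2; apply: (subv_trans H2); rewrite subv_add addvSl /=.
by apply: (subv_trans H1); rewrite addvS // limgS // homcolS.
Qed.

Lemma hom0_ext t s (f : mx A (size t) (size s)) U W V : (U <= W)%VS ->
  hom0 f U W -> hom0 f W V -> hom0 f U V.
Proof.
move=> UW /hom0P H1 /hom0P H2; apply/hom0P => x xV fx; apply: (H1) => //.
by apply: H2 => //; exact: (subvP (homcolS s UW)).
Qed.

(** * The Euler form and its sign *)

Section Euler.
Variables (theta : 'I_n -> int) (f : mx A (size (summ0 theta)) (size (summ1 theta))).
Variables (U V : {vspace M}).
Hypotheses (hf : homm e f) (sU : stable act U) (sV : stable act V) (UV : (U <= V)%VS).

Let dU0 := dimvS (homcolS (summ0 theta) UV).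
Let dU1 := dimvS (homcolS (summ1 theta) UV).
Let rk : (\dim (Gact f @: homcol (summ0 theta) V + homcol (summ1 theta) U)
    <= \dim (homcol (summ0 theta) V) + \dim (homcol (summ1 theta) U)
       - \dim (homcol (summ0 theta) U))%N /\
  (\dim (Gact f @: homcol (summ0 theta) V + homcol (summ1 theta) U)
    <= \dim (homcol (summ1 theta) V))%N.
Proof. by split; [exact: rank_le|apply/dimvS/rank_sub]. Qed.

Lemma ext0_tval : ext0 f U V -> 0 <= tval e theta act U V.
Proof. by rewrite ext0_dim // tval_homcol; move: rk dU0 dU1 => []; lia. Qed.

Lemma hom0_tval : hom0 f U V -> tval e theta act U V <= 0.
Proof. by rewrite hom0_dim // tval_homcol; move: rk dU0 dU1 => []; lia. Qed.

(** Source and target of Hom(P_0, V/U) -> Hom(P_1, V/U) have equal dimension, so surjectivity and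
    injectivity coincide. *)
Lemma ext0_hom0 : tval e theta act U V = 0 -> ext0 f U V = hom0 f U V.
Proof.
rewrite ext0_dim // hom0_dim // tval_homcol; move: rk dU0 dU1 => [].
move: (\dim (_ + _)) (\dim (homcol _ V)) (\dim (homcol _ U)) (\dim (homcol _ V))
  (\dim (homcol _ U)).
by move=> a b c d c' H1 H2 H3 H4 H5; clear -H1 H2 H3 H4 H5; apply/idP/idP; lia.

Qed.

End Euler.

Lemma ext0_inT theta (f : mx A (size (summ0 theta)) (size (summ1 theta))) U V :
  homm e f -> stable act U -> stable act V ->
  ext0 f U V -> inT e theta act U V.
Proof.
move=> hf sU sV fUV W sW UW WV; apply: ext0_tval hf sW sV WV _.
exact: ext0_quo fUV.
Qed.

Lemma hom0_inF theta (f : mx A (size (summ0 theta)) (size (summ1 theta))) U V :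
  homm e f -> stable act U -> stable act V ->
  hom0 f U V -> inF e theta act U V.
Proof.
move=> hf sU sV fUV W sW UW WV; apply: hom0_tval hf sU sW UW _.
exact: hom0_sub fUV.
Qed.

End Columns.

(** * Semistability of E-tame presentations *)

Section Homm.
Variables (k : fieldType) (A : falgType k) (n : nat) (e : 'I_n -> A).
Hypothesis idem_e : forall i, e i * e i = e i.

(** The form in which irreducibility of the variety of presentations enters [general_and]. *)
Lemma homm_linear t s c (x y : mx A (size t) (size s)) :
  homm e x -> homm e y -> homm e (c *: x + y).
Proof.
move=> hx hy i j; rewrite !ffunE [in LHS]hx [in LHS]hy.
by rewrite mulrDr mulrDl -scalerAr -scalerAl.
Qed.

Definition mxunit (t s : seq 'I_n) (r : 'I_(size t)) (c : 'I_(size s)) (a : A) :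
    mx A (size t) (size s) :=
  [ffun rc => if rc == (r, c) then e (lab r) * a * e (lab c) else 0].

Lemma homm_mxunit t s r c a : homm e (@mxunit t s r c a).
Proof.
move=> i j; rewrite ffunE; case: eqP => [[-> ->]|_]; last by rewrite mulr0 mul0r.
by rewrite !mulrA idem_e -!mulrA idem_e.
Qed.

(* Hom(P_f, P_g[1]) = 0 in the homotopy category *)
Definition nullhom t1 s1 t2 s2 (f : mx A (size t1) (size s1))
    (g : mx A (size t2) (size s2)) :=
  forall h : mx A (size t2) (size s1), homm e h ->
  exists (a : mx A (size t2) (size t1)) (b : mx A (size s2) (size s1)),
    [/\ homm e a, homm e b & h = mxmul a f + mxmul g b].

End Homm.

Section Semistable.
Variables (k : closedFieldType) (A : falgType k) (n : nat) (e : 'I_n -> A).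
Hypothesis idem_e : forall i, e i * e i = e i.
Variables (M : vectType k) (act : A -> 'End(M)).
Hypothesis act_ok : ract_ok act.

(** Surjectivity is a lower bound on a rank, and [Gact] is linear in the matrix, so the condition is
    open. *)
Lemma ext0_general t s (f : mx A (size t) (size s)) U V :
  homm e f -> stable act U -> stable act V -> (U <= V)%VS ->
  ext0 e act f U V ->
  general (@homm _ _ _ e t s) (fun f => ext0 e act f U V).
Proof.
move=> hf sU sV UV; rewrite ext0_dim // => Hf.
apply: (general_sub _ (@rank_general _ _ _ _ (@homm _ _ _ e t s) _ (homcol e act t V)
  (homcol e act s U) f (@Gact_linear _ _ _ _ act_ok _ _) hf)).
by move=> g hg; rewrite ext0_dim //; exact: leq_trans.
Qed.

Lemma hom0_general t s (f : mx A (size t) (size s)) U V :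
  homm e f -> stable act U -> stable act V -> (U <= V)%VS ->
  hom0 e act f U V ->
  general (@homm _ _ _ e t s) (fun f => hom0 e act f U V).
Proof.
move=> hf sU sV UV; rewrite hom0_dim // => Hf.
apply: (general_sub _ (@rank_general _ _ _ _ (@homm _ _ _ e t s) _ (homcol e act t V)
  (homcol e act s U) f (@Gact_linear _ _ _ _ act_ok _ _) hf)).
by move=> g hg; rewrite hom0_dim //; exact: leq_trans.
Qed.

Variables (theta : 'I_n -> int).
Local Notation t := (summ0 theta).
Local Notation s := (summ1 theta).
Variables (f g : mx A (size t) (size s)).
Hypotheses (hf : homm e f) (hg : homm e g) (fg : nullhom e f g).

Lemma Gact_mxunit (x : {ffun 'I_(size t) -> M}) r c a :
  act (e (lab r)) (x r) = x r ->
  Gact act (@mxunit _ A n e t s r c a) x = fdelta c (act (a * e (lab c)) (x r)).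
Proof.
move=> xr; apply/ffunP => j; rewrite GactE ffunE (bigD1 r) //= ffunE.
rewrite big1 ?addr0 => [|i ir]; last first.
  by rewrite ffunE xpair_eqE (negPf ir) (act0 act_ok).
rewrite xpair_eqE eqxx /=; case: eqP => [_|]; last by rewrite (act0 act_ok).
by rewrite -mulrA (actM act_ok) xr.
Qed.

Lemma fdelta_homcol q (c : 'I_(size q)) W x : stable act W -> x \in W ->
  fdelta c (act (e (lab c)) x) \in homcol e act q W.
Proof.
move=> sW xW; apply/(mem_homcol idem_e act_ok _ sW) => j; rewrite ffunE.
case: eqP => [->|_]; last by rewrite mem0v linear0.
by rewrite -(actM act_ok) idem_e; split=> //; exact: (stableP act W).1 sW _ _ xW.
Qed.

(* If ext0 fails for f, then Hom(V/U, K_{nu f}) != 0; the subspace W below is the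
   kernel of a nonzero map to K_{nu f}, on whose image hom0 g holds. *)
Lemma ext0_quotient U V : stable act U -> stable act V -> (U <= V)%VS ->
  ~~ ext0 e act f U V ->
  exists W : {vspace M}, [/\ stable act W, (U <= W)%VS, (W <= V)%VS,
    (\dim W < \dim V)%N & hom0 e act g W V].
Proof.
move=> sU sV UV /subvPn[y yV /separating_form[xi xi0 xiy]].
have sU' := (stableP act U).1 sU; have sV' := (stableP act V).1 sV.
(* The functional [xi] corresponds to a map from V/U to K_{nu f}, sending [x] to the functional with
   value [xi] of x a e_{s_c}, placed at position [c], on the vector with entry a e_{s_c} there. *)
have [W WP] : exists W : {vspace M}, forall x, x \in W <-> (x \in V /\
    forall c a, xi (fdelta c (act (a * e (lab (s:=s) c)) x)) = 0).
  apply: subspace_ex => [|z u v [uV u0] [vV v0]].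
    by split=> [|c a]; rewrite ?mem0v // linear0 -fdeltaE !linear0.
  split=> [|c a]; first by rewrite memvD // memvZ.
  by rewrite -fdeltaE !linearP /= !fdeltaE u0 v0 scaler0 addr0.
have sW : stable act W.
  apply/stableP => a x /WP[xV x0]; apply/WP; split; first exact: sV'.
  by move=> c b; rewrite -(actM act_ok) mulrA.
have WV : (W <= V)%VS by apply/subvP => x /WP[].
have UW : (U <= W)%VS.
  apply/subvP => x xU; apply/WP; split; first exact: (subvP UV).
  move=> c a; apply: xi0; rewrite (actM act_ok).
  by apply: (subvP (addvSr _ _)); apply: fdelta_homcol => //; exact: sU'.
have xiW x : x \in homcol e act s W -> xi x = 0.
  move=> /(mem_homcol idem_e act_ok _ sW) xW; rewrite [x]sum_fdelta linear_sum big1 //= => c _.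
  have [/WP[_ /(_ c 1) x0] xe] := xW c.
  by move: x0; rewrite mul1r xe.
exists W; split=> //.
  rewrite ltnNge; apply/negP => VW.
  have WE : W = V by apply/eqP; rewrite eqEdim WV.
  by move/eqP: xiy; apply; apply: xiW; rewrite WE.
apply/hom0P => x xV gx; apply/(mem_homcol idem_e act_ok _ sW) => r.
have [xrV xre] := (mem_homcol idem_e act_ok x sV).1 xV r.
split=> //; apply/WP; split=> // c a.
(* The elementary matrix is null-homotopic. On [x], the term through [f] lands in the image of [f],
   which [xi] kills; the term through [g] lands in [homcol e act s W], killed by [xiW]. *)
have [a' [b' [ha hb hE]]] := fg (homm_mxunit idem_e r c a).
rewrite -Gact_mxunit // hE (GactD act_ok) !(Gact_mul act_ok) linearD /=.
rewrite xi0 ?add0r; first exact/xiW/Gact_homcol.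
apply: (subvP (addvSl _ _)); apply: memv_img; exact: Gact_homcol.
Qed.

(* If hom0 fails for g, then Hom(C_g, V/U) != 0; W/U below is the image of a
   nonzero map from C_g, and ext0 f holds for it. *)
Lemma hom0_submodule U V : stable act U -> stable act V -> (U <= V)%VS ->
  ~~ hom0 e act g U V ->
  exists W : {vspace M}, [/\ stable act W, (U <= W)%VS, (W <= V)%VS,
    (\dim U < \dim W)%N & ext0 e act f U W].
Proof.
move=> sU sV UV /subvPn[x]; rewrite memv_cap -memv_preim => /andP[xV gx xU].
have sU' := (stableP act U).1 sU; have sV' := (stableP act V).1 sV.
have [W WP] : exists W : {vspace M}, forall z, z \in W <-> (exists (b : 'I_(size t) -> A),
    z - \sum_r act (b r) (x r) \in U).
  apply: subspace_ex => [|z u v [b bU] [d dU]].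
    by exists (fun=> 0); rewrite big1 ?subr0 ?mem0v // => r _; rewrite act0.
  exists (fun r => z *: b r + d r).
  have -> : z *: u + v - \sum_r act (z *: b r + d r) (x r) =
     z *: (u - \sum_r act (b r) (x r)) + (v - \sum_r act (d r) (x r)).
    rewrite scalerBr addrACA; congr (_ + _).
    rewrite -opprD; congr (- _); rewrite scaler_sumr -big_split; apply: eq_bigr => r _.
    by rewrite actP.
  by rewrite memvD // memvZ.
have xP := (mem_homcol idem_e act_ok x sV).1 xV.
have sW : stable act W.
  apply/stableP => a z /WP[b bU]; apply/WP; exists (fun r => b r * a).
  have -> : act a z - \sum_r act (b r * a) (x r) = act a (z - \sum_r act (b r) (x r)).
    rewrite linearB /= (linear_sum (act a)); congr (_ - _).
    by apply: eq_bigr => r _; rewrite (actM act_ok).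
  exact: sU'.
have UW : (U <= W)%VS.
  apply/subvP => z zU; apply/WP; exists (fun=> 0).
  by rewrite big1 ?subr0 // => r _; rewrite act0.
have WV : (W <= V)%VS.
  apply/subvP => z /WP[b]; rewrite -[X in _ -> X \in _](subrK (\sum_r act (b r) (x r))).
  move=> bU; apply: memvD; first exact: (subvP UV).
  by apply: memv_suml => r _; apply: sV'; case: (xP r).
have xW : x \in homcol e act t W.
  apply/(mem_homcol idem_e act_ok _ sW) => r; split; last by case: (xP r).
  apply/WP; exists (fun r' => if r' == r then 1 else 0).
  rewrite (bigD1 r) //= eqxx (act1E act_ok) big1 ?addr0 ?subrr ?mem0v // => i /negPf ->.
  by rewrite act0.
exists W; split=> //.
  rewrite ltnNge; apply: contra xU => WU.
  have -> : U = W by apply/eqP; rewrite eqEdim UW.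
  exact: xW.
apply/subvP => y /(mem_homcol idem_e act_ok _ sW) yW.
have /choice[b bP] : forall c, exists b : 'I_(size t) -> A,
    y c - \sum_r act (b r) (x r) \in U by move=> c; apply/WP; case: (yW c).
(* The coefficients expressing [y] through [x] modulo [U] are collected in a matrix. Writing it as
   a' f + g b' shows that [y] is the image under [f] of a' x modulo [U], because g x lies in [U]. *)
pose h : mx A (size t) (size s) :=
  [ffun rc => e (lab rc.1) * b rc.2 rc.1 * e (lab rc.2)].
have hh : homm e h.
  by move=> i j; rewrite ffunE /= !mulrA idem_e -!mulrA idem_e.
have [a' [b' [ha hb hE]]] := fg hh.
have yh : y - Gact act h x \in homcol e act s U.
  apply/(mem_homcol idem_e act_ok _ sU) => c.
  have -> : (y - Gact act h x) c =
      act (e (lab c)) (y c - \sum_r act (b c r) (x r)).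
    rewrite !ffunE GactE linearB /= (yW c).2 (linear_sum (act _)); congr (_ - _).
    by apply: eq_bigr => r _; rewrite ffunE /= -mulrA !(actM act_ok) (xP r).2.
  by rewrite -(actM act_ok) idem_e; split=> //; exact: sU'.
rewrite -[y](subrK (Gact act h x)) hE (GactD act_ok) !(Gact_mul act_ok).
rewrite addrC -addrA memv_add //.
  by apply: memv_img; exact: Gact_homcol.
apply: memvD; first exact: (Gact_homcol idem_e act_ok sU).
by rewrite -(Gact_mul act_ok) -(Gact_mul act_ok) -GactD // -hE.
Qed.

Lemma inT_ext0 U V : stable act U -> stable act V -> (U <= V)%VS ->
  inT e theta act U V ->
  exists2 f' : mx A (size t) (size s), homm e f' & ext0 e act f' U V.
Proof.
have [m] := ubnP (\dim V); elim: m V => // m IHm V dV sU sV UV TV.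
have [fUV|nf] := boolP (ext0 e act f U V); first by exists f.
have [W [sW UW WV dW gW]] := ext0_quotient sU sV UV nf.
(* Nonnegative because V/W is a factor module of V/U, nonpositive because [hom0] holds for [g]. *)
have W0 : tval e theta act W V = 0.
  by apply: le_anti; rewrite TV // (hom0_tval idem_e act_ok hg) //.
have TW : inT e theta act U W.
  move=> Z sZ UZ ZW; have -> : tval e theta act Z W = tval e theta act Z V.
    by rewrite -(tvalD e act theta Z W V) W0 addr0.
  by apply: TV => //; exact: subv_trans WV.
have [f1 hf1 f1W] := IHm W (leq_trans dW dV) sU sW UW TW.
(* Now [f1] serves W/U and [g] serves V/W; both conditions are open, so one matrix serves both. *)
have gext : ext0 e act g W V by rewrite ext0_hom0.
have [f2 hf2 [H1 H2]] := general_ex (general_and (@homm_linear _ _ _ e t s)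
  (ext0_general hf1 sU sW UW f1W) (ext0_general hg sW sV WV gext)).
by exists f2 => //; exact: ext0_ext H1 H2.
Qed.

(** Dual induction: the image of a map from C_g is split off as a submodule W/U, and the factor
    module V/W stays in F_theta. *)
Lemma inF_hom0 U V : stable act U -> stable act V -> (U <= V)%VS ->
  inF e theta act U V ->
  exists2 f' : mx A (size t) (size s), homm e f' & hom0 e act f' U V.
Proof.
have [m] := ubnP (\dim V - \dim U); elim: m U => // m IHm U dU sU sV UV FV.
have [gUV|ng] := boolP (hom0 e act g U V); first by exists g.
have [W [sW UW WV dW fW]] := hom0_submodule sU sV UV ng.
have W0 : tval e theta act U W = 0.
  by apply: le_anti; rewrite FV // (ext0_tval idem_e act_ok hf).
have FW : inF e theta act W V.
  move=> Z sZ WZ ZV; have -> : tval e theta act W Z = tval e theta act U Z.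
    by rewrite -(tvalD e act theta U W Z) W0 add0r.
  by apply: FV => //; exact: subv_trans WZ.
have dWm : (\dim V - \dim W < m)%N.
  have := dimvS WV; move: dU dW.
  by move: (\dim V) (\dim U) (\dim W) => a b c H1 H2 H3; clear -H1 H2 H3; lia.
have [f1 hf1 f1W] := IHm W dWm sW sV WV FW.
have fhom : hom0 e act f U W by rewrite -ext0_hom0.
have [f2 hf2 [H1 H2]] := general_ex (general_and (@homm_linear _ _ _ e t s)
  (hom0_general hf1 sW sV WV f1W) (hom0_general hf sU sW UW fhom)).
by exists f2 => //; exact: hom0_ext H2 H1.
Qed.

End Semistable.

(** * Cokernels and kernels of the Nakayama functor *)

Section Projectives.
Variables (k : fieldType) (A : falgType k) (n : nat) (e : 'I_n -> A).
Hypothesis idem_e : forall i, e i * e i = e i.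

(** Common form of [Pspace] and [Lspace], with [phi c] left, respectively right, multiplication by
    an idempotent. *)
Lemma mem_span_delta m (phi : 'I_m -> 'End(A)) (x : {ffun 'I_m -> A}) :
  x \in <<[seq [ffun c' => if c' == c then phi c b else 0%R]
          | c <- enum 'I_m, b : A <- vbasis (fullv : {vspace A})]>>%VS <->
  (forall c, x c \in limg (phi c)).
Proof.
split=> [|xP].
  have [W WP] : exists W : {vspace {ffun 'I_m -> A}}, forall y, y \in W <->
      (forall c, y c \in limg (phi c)).
    apply: subspace_ex => [c|z u v uP vP c]; rewrite !ffunE ?mem0v //.
    by rewrite memvD // memvZ.
  move=> xS; apply/WP; apply: (subvP _ _ xS); apply/span_subvP => y.
  move=> /allpairsP[[c b] /= [_ _ ->]]; apply/WP => j; rewrite ffunE.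
  by case: eqP => [->|_]; rewrite ?mem0v // memv_img ?memvf.
rewrite [x](@sum_fdelta _ A); apply: memv_suml => c _.
have /memv_imgP[a _ ->] := xP c.
rewrite (coord_vbasis (memvf a)) linear_sum -fdeltaE linear_sum; apply: memv_suml => i _.
rewrite !linearZ /= fdeltaE memvZ // memv_span //.
by apply/allpairsP; exists (c, (vbasis fullv)`_i); rewrite /= mem_enum mem_nth ?size_tuple.
Qed.

Lemma mem_Pspace t (x : {ffun 'I_(size t) -> A}) :
  x \in Pspace e t <-> forall r, e (lab r) * x r = x r.
Proof.
have E r : linfun (fun b : A => e (lab (s:=t) r) * b) =1 (fun b => e (lab r) * b).
  by apply: linfunE => c u v; rewrite mulrDr scalerAr.
have -> : Pspace e t = <<[seq [ffun c' => if c' == c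
    then linfun (fun b : A => e (lab (s:=t) c) * b)%R b else 0%R]
    | c <- enum 'I_(size t), b : A <- vbasis (fullv : {vspace A})]>>%VS.
  rewrite /Pspace /Pgen; congr (<< _ >>)%VS; apply: eq_allpairs => c b.
  by apply/ffunP => j; rewrite !ffunE E.
rewrite mem_span_delta; split=> xP r.
  by have /memv_imgP[a _ ->] := xP r; rewrite E mulrA idem_e.
by apply/memv_imgP; exists (x r); rewrite ?memvf // E xP.
Qed.

Lemma mem_Lspace t (x : {ffun 'I_(size t) -> A}) :
  x \in Lspace e t <-> forall r, x r * e (lab r) = x r.
Proof.
have E r : linfun (fun b : A => b * e (lab (s:=t) r)) =1 (fun b => b * e (lab r)).
  by apply: linfunE => c u v; rewrite mulrDl scalerAl.
have -> : Lspace e t = <<[seq [ffun c' => if c' == c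
    then linfun (fun b : A => b * e (lab (s:=t) c))%R b else 0%R]
    | c <- enum 'I_(size t), b : A <- vbasis (fullv : {vspace A})]>>%VS.
  rewrite /Lspace /Lgen; congr (<< _ >>)%VS; apply: eq_allpairs => c b.
  by apply/ffunP => j; rewrite !ffunE E.
rewrite mem_span_delta; split=> xP r.
  by have /memv_imgP[a _ ->] := xP r; rewrite E -mulrA idem_e.
by apply/memv_imgP; exists (x r); rewrite ?memvf // E xP.
Qed.

Lemma ractvE m a (x : {ffun 'I_m -> A}) r : ractv m a x r = x r * a.
Proof.
rewrite /ractv linfunE ?ffunE // => c u v; apply/ffunP => j; rewrite !ffunE.
by rewrite mulrDl scalerAl.
Qed.

Lemma ractv_ok m : ract_ok (@ractv k A m).
Proof.
split=> [|a b|c a b]; apply/lfunP => x; apply/ffunP => r.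
- by rewrite ractvE mulr1 id_lfunE.
- by rewrite comp_lfunE !ractvE mulrA.
by rewrite add_lfunE scale_lfunE !ffunE !ractvE mulrDr scalerAr.
Qed.

Lemma mem_Imf t s (f : mx A (size t) (size s)) y :
  y \in Imf e f <-> exists2 z, z \in Pspace e s & y = applyf f z.
Proof.
have E : linfun (applyf f) =1 applyf f.
  apply: linfunE => c u v; apply/ffunP => r; rewrite !ffunE.
  rewrite scaler_sumr -big_split; apply: eq_bigr => j _.
  by rewrite !ffunE mulrDr scalerAr.
have -> : Imf e f = (linfun (applyf f) @: Pspace e s)%VS.
  by rewrite limg_span; congr (<< _ >>)%VS; apply: eq_map => z; rewrite E.
split=> [/memv_imgP[z zP ->]|[z zP ->]]; first by exists z; rewrite ?E.
by apply/memv_imgP; exists z; rewrite ?E.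
Qed.

Lemma Pspace_stable t : stable (@ractv k A (size t)) (Pspace e t).
Proof.
apply/stableP => a x /mem_Pspace xP; apply/mem_Pspace => r.
by rewrite !ractvE mulrA xP.
Qed.

Lemma Imf_stable t s (f : mx A (size t) (size s)) :
  stable (@ractv k A (size t)) (Imf e f).
Proof.
apply/stableP => a x /mem_Imf[z zP ->]; apply/mem_Imf; exists (ractv _ a z).
  by have /stableP := @Pspace_stable s; apply.
apply/ffunP => r; rewrite ractvE !ffunE mulr_suml; apply: eq_bigr => c _.
by rewrite ractvE mulrA.
Qed.

Lemma Imf_Pspace t s (f : mx A (size t) (size s)) :
  homm e f -> (Imf e f <= Pspace e t)%VS.
Proof.
move=> hf; apply/subvP => x /mem_Imf[z zP ->]; apply/mem_Pspace => r.
rewrite ffunE mulr_sumr; apply: eq_bigr => c _.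
by rewrite hf !mulrA idem_e.
Qed.

Lemma hommP t s (f : mx A (size t) (size s)) : homm e f <->
  forall r c, e (lab r) * f (r, c) = f (r, c) /\ f (r, c) * e (lab c) = f (r, c).
Proof.
split=> hf r c; last by have [-> ->] := hf r c.
by rewrite hf; split; rewrite ?mulrA ?idem_e // -!mulrA idem_e.
Qed.

(* Hom(P_f, C_g[1]) = Hom(P_f, P_g[1]) because P_f has no terms in degrees > 0. *)
Lemma nullhom_ext0 t1 s1 t2 s2 (f : mx A (size t1) (size s1))
    (g : mx A (size t2) (size s2)) : homm e f -> homm e g ->
  nullhom e f g <-> ext0 e (@ractv k A (size t2)) f (Imf e g) (Pspace e t2).
Proof.
move=> hf hg.
have okR := @ractv_ok (size t2).
have sP := @Pspace_stable t2.
have sI := Imf_stable g.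
split=> [fg|fg h hh].
  apply/subvP => y /(mem_homcol idem_e okR _ sP) yP.
  pose h : mx A (size t2) (size s1) := [ffun rc => y rc.2 rc.1].
  have hh : homm e h.
    apply/hommP => r c; rewrite ffunE /=; have [/mem_Pspace -> /ffunP/(_ r)] := yP c.
    by rewrite ractvE.
  have [a [b [/hommP ha /hommP hb hE]]] := fg h hh.
  pose x : {ffun 'I_(size t1) -> {ffun 'I_(size t2) -> A}} :=
    [ffun j => [ffun r => a (r, j)]].
  have xE : Gact (@ractv k A _) f x =
      [ffun c => [ffun r => mxmul a f (r, c)]].
    apply/ffunP => c; apply/ffunP => r; rewrite GactE sum_ffunE !ffunE.
    by apply: eq_bigr => j _; rewrite ractvE !ffunE.
  apply/memv_addP; exists (Gact (@ractv k A _) f x).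
    apply: memv_img; apply/(mem_homcol idem_e okR _ sP) => j; split.
      by apply/mem_Pspace => r; rewrite !ffunE (ha r j).1.
    by apply/ffunP => r; rewrite ractvE !ffunE (ha r j).2.
  exists (y - Gact (@ractv k A _) f x); last by rewrite addrC subrK.
  have uE c : (y - Gact (@ractv k A _) f x) c = applyf g [ffun j => b (j, c)].
    apply/ffunP => r; rewrite xE !ffunE.
    move: hE => /ffunP/(_ (r, c)); rewrite !ffunE /= => ->.
    by rewrite addrAC subrr add0r; apply: eq_bigr => j _; rewrite ffunE.
  apply/(mem_homcol idem_e okR _ sI) => c; rewrite uE; split.
    apply/mem_Imf; eexists; last by [].
    by apply/mem_Pspace => j; rewrite ffunE (hb j c).1.
  apply/ffunP => r; rewrite ractvE !ffunE mulr_suml; apply: eq_bigr => j _.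
  by rewrite ffunE -mulrA (hb j c).2.
move/hommP in hh.
have : [ffun c => [ffun r => h (r, c)]] \in homcol e (@ractv k A (size t2)) s1 (Pspace e t2).
  apply/(mem_homcol idem_e okR _ sP) => c; rewrite ffunE; split.
    by apply/mem_Pspace => r; rewrite ffunE (hh r c).1.
  by apply/ffunP => r; rewrite ractvE !ffunE (hh r c).2.
move/(subvP fg)/memv_addP => [_ /memv_imgP[x /(mem_homcol idem_e okR _ sP) xP ->]].
move=> [u /(mem_homcol idem_e okR _ sI) uP hE].
have /choice[z zP] : forall c, exists z, z \in Pspace e s2 /\ u c = applyf g z.
  by move=> c; have [/mem_Imf[z zP zE] _] := uP c; exists z.
(* The chosen [z] satisfies only the left idempotent condition. Multiplying on the right by the
   idempotent leaves its image under [g] unchanged, since that image [u c] is fixed by it. *)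
exists [ffun rj => x rj.2 rj.1], [ffun jc => z jc.2 jc.1 * e (lab jc.2)]; split.
- apply/hommP => r j; rewrite ffunE /=; have [/mem_Pspace -> /ffunP/(_ r)] := xP j.
  by rewrite ractvE.
- apply/hommP => j c; rewrite ffunE /= -mulrA idem_e mulrA.
  by have [/mem_Pspace -> _] := zP c.
apply/ffunP => -[r c]; move: hE => /ffunP/(_ c)/ffunP/(_ r); rewrite !ffunE /= => ->.
congr (_ + _).
  by rewrite GactE sum_ffunE; apply: eq_bigr => j _; rewrite ractvE ffunE.
have [_ /ffunP/(_ r)] := uP c; rewrite ractvE => <-.
rewrite (zP c).2 !ffunE mulr_suml; apply: eq_bigr => j _.
by rewrite ffunE /= mulrA.
Qed.

Section Nakayama.
Variable s : seq 'I_n.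
Local Notation L := (Lspace e s).
Local Notation nu := (@nuact k A n e s).

Lemma Lspace_lmul a x : x \in L -> [ffun c => a * x c] \in L.
Proof. by move=> /mem_Lspace xP; apply/mem_Lspace => c; rewrite ffunE -mulrA xP. Qed.

Lemma nuactE a (psi : nuP e s) x : x \in L ->
  nu a psi (vsproj L x) = psi (vsproj L [ffun c => a * x c]).
Proof.
move=> xL; rewrite /nuact linfunE.
  rewrite comp_lfunE linfunE ?vsprojK //.
  move=> c u v; rewrite -linearP /=; congr (vsproj _ _); apply/ffunP => j.
  by rewrite !ffunE mulrDr scalerAr.
move=> c u v; apply/lfunP => y.
by rewrite add_lfunE scale_lfunE !comp_lfunE add_lfunE scale_lfunE.
Qed.

Lemma nuP_ext (psi phi : nuP e s) :
  (forall x, x \in L -> psi (vsproj L x) = phi (vsproj L x)) -> psi = phi.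
Proof. by move=> H; apply/lfunP => X; rewrite -(vsvalK X) H ?subvsP. Qed.

Lemma nuact_ok : ract_ok nu.
Proof.
split=> [|a b|c a b]; apply/lfunP => psi; apply: nuP_ext => x xL.
- rewrite nuactE // id_lfunE; congr (psi (vsproj _ _)).
  by apply/ffunP => j; rewrite ffunE mul1r.
- rewrite comp_lfunE !nuactE ?Lspace_lmul //; congr (psi (vsproj _ _)).
  by apply/ffunP => j; rewrite !ffunE mulrA.
rewrite add_lfunE scale_lfunE add_lfunE scale_lfunE !nuactE // -linearP -linearP /=.
congr (psi (vsproj _ _)); apply/ffunP => j.
by rewrite !ffunE mulrDl scalerAl.
Qed.

End Nakayama.

Lemma homfAE t s (f : mx A (size t) (size s)) x : x \in Lspace e t ->
  homfA e f (vsproj (Lspace e t) x) =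
  vsproj (Lspace e s) [ffun c => \sum_r x r * f (r, c)].
Proof.
move=> xL; rewrite /homfA linfunE ?vsprojK //.
move=> c u v; rewrite -linearP /=; congr (vsproj _ _); apply/ffunP => j.
rewrite !ffunE scaler_sumr -big_split; apply: eq_bigr => r _.
by rewrite !ffunE mulrDl scalerAl.
Qed.

Lemma mem_Knuf t s (f : mx A (size t) (size s)) (psi : nuP e s) :
  psi \in Knuf e f <-> forall x, x \in Lspace e t ->
    psi (vsproj (Lspace e s) [ffun c => \sum_r x r * f (r, c)]) = 0.
Proof.
have E : nuf e f psi = (psi \o homfA e f)%VF.
  rewrite /nuf linfunE // => c u v; apply/lfunP => y.
  by rewrite add_lfunE scale_lfunE !comp_lfunE add_lfunE scale_lfunE.
rewrite /Knuf memv_ker E; split=> [/eqP/lfunP H x xL|H].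
  by rewrite -homfAE // -comp_lfunE H zero_lfunE.
apply/eqP/nuP_ext => x xL.
by rewrite comp_lfunE homfAE // H // zero_lfunE.
Qed.

Lemma Knuf_stable t s (f : mx A (size t) (size s)) : homm e f ->
  stable (@nuact k A n e s) (Knuf e f).
Proof.
move=> /hommP hf; apply/stableP => a psi /mem_Knuf pK; apply/mem_Knuf => x xL.
rewrite nuactE.
  rewrite -[RHS](pK [ffun r => a * x r]) ?Lspace_lmul //.
  congr (psi (vsproj _ _)); apply/ffunP => c; rewrite !ffunE mulr_sumr.
  by apply: eq_bigr => r _; rewrite ffunE mulrA.
apply/mem_Lspace => c; rewrite ffunE mulr_suml; apply: eq_bigr => r _.
by rewrite -mulrA (hf r c).2.
Qed.

Lemma stable0 (M : vectType k) (act : A -> 'End(M)) : stable act 0%VS.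
Proof. by move=> a; rewrite limg0. Qed.

(* D Hom(P_f, P_g[1]) = Hom(P_g, (nu P_f)[-1]); a functional on the matrices h
   vanishing on all a f + g b is the same as a tuple (psi_r) in K_{nu f}
   annihilated by g. *)
Lemma nullhom_hom0 t1 s1 t2 s2 (f : mx A (size t1) (size s1))
    (g : mx A (size t2) (size s2)) : homm e f -> homm e g ->
  nullhom e f g <-> hom0 e (@nuact k A n e s1) g 0%VS (Knuf e f).
Proof.
move=> hf hg.
have okN := nuact_ok s1.
have sK := Knuf_stable hf.
have s0 := @stable0 _ (@nuact k A n e s1).
(* [m r x] has row [x] in position [r], cut down by e_{t_r}, and zeros elsewhere; such rows
   translate tuples [psi] into functionals on matrices. *)
pose m r (x : {ffun 'I_(size s1) -> A}) : mx A (size t2) (size s1) :=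
  [ffun ij => if ij.1 == r then e (lab ij.1) * x ij.2 else 0].
have m_lin r : linear (m r).
  move=> c u v; apply/ffunP => -[i j]; rewrite !ffunE /=.
  by case: eqP => _; rewrite ?scaler0 ?addr0 // ?ffunE mulrDr scalerAr.
have hm r x : x \in Lspace e s1 -> homm e (m r x).
  move=> /mem_Lspace xP; apply/hommP => i j; rewrite ffunE /=.
  by case: eqP => _; rewrite ?mulr0 ?mul0r // mulrA idem_e -mulrA xP.
have row_L t (h : mx A (size t) (size s1)) i : homm e h ->
    [ffun c => h (i, c)] \in Lspace e s1.
  by move=> /hommP hh; apply/mem_Lspace => c; rewrite ffunE (hh i c).2.
split=> [fg|fg h hh].
  apply/hom0P => psi /(mem_homcol idem_e okN _ sK) psiP.
  move=> /(mem_homcol idem_e okN _ s0) gpsi.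
  apply/(mem_homcol idem_e okN _ s0) => r0; split; last by case: (psiP r0).
  rewrite memv0; apply/eqP/nuP_ext => x xL; rewrite zero_lfunE.
  have [a [b [ha hb hE]]] := fg _ (hm r0 x xL).
  (* The functional attached to [psi], evaluated on [m r0 x]. Its part on a f vanishes since each
     [psi r] lies in K_{nu f}, and its part on g b vanishes since [g] annihilates [psi]. *)
  transitivity (\sum_r psi r (vsproj (Lspace e s1) [ffun c => m r0 x (r, c)])).
    rewrite (bigD1 r0) //= big1 ?addr0 => [|r r0r].
      rewrite -{1}(psiP r0).2 nuactE //; congr (psi _ (vsproj _ _)).
      by apply/ffunP => c; rewrite !ffunE /= eqxx.
    rewrite [X in vsproj _ X](_ : _ = 0) ?linear0 //.
    by apply/ffunP => c; rewrite !ffunE /= (negPf r0r).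
  rewrite hE; transitivity (\sum_r \sum_c psi r (vsproj (Lspace e s1)
      [ffun c' => g (r, c) * [ffun c'' => b (c, c'')] c'])).
    apply: eq_bigr => r _; rewrite -linear_sum -linear_sum /=.
    have K0 : psi r (vsproj (Lspace e s1)
        [ffun c => \sum_j [ffun j => a (r, j)] j * f (j, c)]) = 0.
      apply: (mem_Knuf f (psi r)).1 (psiP r).1 _ _; apply/mem_Lspace => j.
      by move/hommP: ha => /(_ r j)[_]; rewrite ffunE.
    rewrite -[RHS]add0r -[in RHS]K0 -linearD -linearD /=.
    congr (psi _ (vsproj _ _)); apply/ffunP => c; rewrite !ffunE /= sum_ffunE.
    by congr (_ + _); apply: eq_bigr => j _; rewrite !ffunE.
  rewrite exchange_big big1 // => c _.
  have := (gpsi c).1; rewrite memv0 GactE => /eqP/lfunP/(_ (vsproj _ [ffun c'' => b (c, c'')])).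
  rewrite sum_lfunE zero_lfunE; apply: etrans; apply: eq_bigr => r _.
  by rewrite nuactE //; exact: row_L.
apply: contrapT => nh.
(* The null-homotopic matrices form a subspace. A functional vanishing on it but not at [h] produces
   a tuple [psi] that [fg] forces to be zero. *)
have [T TP] : exists T : {vspace mx A (size t2) (size s1)}, forall h, h \in T <->
    (exists (a : mx A (size t2) (size t1)) (b : mx A (size s2) (size s1)),
    [/\ homm e a, homm e b & h = mxmul a f + mxmul g b]).
  apply: subspace_ex => [|z u v [a [b [ha hb ->]]] [a' [b' [ha' hb' ->]]]].
    exists 0, 0; split; try by move=> i j; rewrite ffunE mulr0 mul0r.
    apply/ffunP => -[i j]; rewrite !ffunE !big1 ?addr0 // => l _.
      by rewrite ffunE mulr0.
    by rewrite ffunE mul0r.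
  exists (z *: a + a'), (z *: b + b'); split; try exact: homm_linear.
  apply/ffunP => -[i j]; rewrite !ffunE /= scalerDr addrACA.
  congr (_ + _); rewrite scaler_sumr -big_split; apply: eq_bigr => l _ /=.
    by rewrite !ffunE mulrDl scalerAl.
  by rewrite !ffunE mulrDr scalerAr.
have /separating_form[Psi Psi0 Psih] : h \notin T by apply/negP => /TP.
pose psi : {ffun 'I_(size t2) -> nuP e s1} :=
  [ffun r => linfun (fun X : subvs_of (Lspace e s1) => Psi (m r (vsval X)))].
have psiE r x : x \in Lspace e s1 -> psi r (vsproj _ x) = Psi (m r x).
  move=> xL; rewrite ffunE linfunE ?vsprojK // => c u v.
  by rewrite linearP /= m_lin linearP.
have psi_in : psi \in homcol e (@nuact k A n e s1) t2 (Knuf e f).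
  apply/(mem_homcol idem_e okN _ sK) => r; split.
    apply/mem_Knuf => x /mem_Lspace xL; rewrite psiE; last first.
      apply/mem_Lspace => c; rewrite ffunE mulr_suml; apply: eq_bigr => j _.
      by rewrite -mulrA; move/hommP: hf => /(_ j c)[_ ->].
    apply: Psi0; apply/TP.
    (* A matrix whose only row is x f, in position [r], is the matrix with only row [x] multiplied
       by [f]. *)
    exists [ffun ij => if ij.1 == r then e (lab ij.1) * x ij.2 else 0], 0; split.
    - apply/hommP => i j; rewrite ffunE /=.
      by case: eqP => _; rewrite ?mulr0 ?mul0r // mulrA idem_e -mulrA xL.
    - by move=> i j; rewrite ffunE mulr0 mul0r.
    apply/ffunP => -[i j]; rewrite !ffunE /= [X in _ + X]big1 ?addr0; last first.
      by move=> l _; rewrite ffunE mulr0.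
    case: eqP => ir; last first.
      by rewrite big1 // => l _; rewrite ffunE /=; case: eqP ir => // _ _; rewrite mul0r.
    rewrite mulr_sumr; apply: eq_bigr => l _.
    by rewrite ffunE /= ir eqxx mulrA.
  apply: nuP_ext => x xL; rewrite nuactE // !psiE ?Lspace_lmul //; congr (Psi _).
  apply/ffunP => -[i j]; rewrite !ffunE /=; case: eqP => // ->.
  by rewrite mulrA idem_e.
have gpsi : Gact (@nuact k A n e s1) g psi \in homcol e (@nuact k A n e s1) s2 0%VS.
  apply/(mem_homcol idem_e okN _ s0) => c.
  suff -> : Gact (@nuact k A n e s1) g psi c = 0 by rewrite mem0v linear0.
  apply: nuP_ext => x xL; rewrite GactE sum_lfunE zero_lfunE.
  under eq_bigr => r _ do rewrite nuactE // psiE ?Lspace_lmul //.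
  rewrite -linear_sum /=; apply: Psi0; apply/TP.
  (* The sum of the matrices with row g(r, c) x is column [c] of [g] times the row [x], that is, g b
     with [b] having only row [x], in position [c]. *)
  exists 0, [ffun ij => if ij.1 == c then e (lab ij.1) * x ij.2 else 0]; split.
  - by move=> i j; rewrite ffunE mulr0 mul0r.
  - move/mem_Lspace in xL; apply/hommP => i j; rewrite ffunE /=.
    by case: eqP => _; rewrite ?mulr0 ?mul0r // mulrA idem_e -mulrA xL.
  apply/ffunP => -[i j]; rewrite sum_ffunE !ffunE /= [X in X + _]big1 ?add0r; last first.
    by move=> l _; rewrite ffunE mul0r.
  rewrite (bigD1 i) //= [in RHS](bigD1 c) //= !big1 ?addr0.
  - move/hommP: hg => hg; rewrite !ffunE /= !eqxx mulrA (hg i c).1.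
    by rewrite mulrA (hg i c).2.
  - by move=> l lc; rewrite ffunE /= (negPf lc) mulr0.
  by move=> l li; rewrite ffunE /= eq_sym (negPf li).
have psi0 r : psi r = 0.
  have /(mem_homcol idem_e okN _ s0)/(_ r)[] := hom0P _ _ _ _ _ fg _ psi_in gpsi.
  by rewrite memv0 => /eqP.
move/eqP: Psih; apply.
have -> : h = \sum_r m r [ffun c => h (r, c)].
  apply/ffunP => -[i j]; rewrite sum_ffunE (bigD1 i) //= big1 ?addr0.
    by rewrite !ffunE /= eqxx; move/hommP: hh => /(_ i j)[-> _].
  by move=> l li; rewrite ffunE /= eq_sym (negPf li).
rewrite linear_sum big1 //= => r _.
by rewrite -(psiE r) ?psi0 ?zero_lfunE //; exact: row_L.
Qed.

End Projectives.

(** * Quotient modules *)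

Section Quotient.
Variables (k : fieldType) (A : falgType k) (n : nat) (e : 'I_n -> A).
Hypothesis idem_e : forall i, e i * e i = e i.
Variables (M : vectType k) (act : A -> 'End(M)).
Hypothesis act_ok : ract_ok act.
Variables U V : {vspace M}.
Hypotheses (sU : stable act U) (sV : stable act V) (UV : (U <= V)%VS).

Local Notation C := (V :\: U)%VS.
Let sU' := (stableP act U).1 sU.
Let sV' := (stableP act V).1 sV.

(** V/U is realised on a complement of [U] in [V], by projecting along [U]. This makes subquotients
    into full modules, the only ones that [TF_equiv] tests. *)
Definition quo_pi : 'Hom(M, subvs_of C) := (linfun (vsproj C) \o daddv_pi C U)%VF.
Definition quo_act (a : A) : 'End(subvs_of C) :=
  (quo_pi \o act a \o linfun (vsval : subvs_of C -> M))%VF.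

Lemma quo_piE x : vsval (quo_pi x) = daddv_pi C U x.
Proof. by rewrite comp_lfunE lfunE /= vsprojK // memv_pi. Qed.

Lemma quo_pi_sub x : x \in V -> x - vsval (quo_pi x) \in U.
Proof.
move=> xV; rewrite quo_piE -{1}(daddv_pi_add (capv_diff V U) (w := x)).
  by rewrite addrAC subrr add0r memv_pi.
by rewrite addv_diff; move/addv_idPl: UV => ->.
Qed.

Lemma quo_pi0 x : x \in V -> (quo_pi x == 0) = (x \in U).
Proof.
move=> xV; apply/eqP/idP => [x0|xU].
  by have := quo_pi_sub xV; rewrite x0 [vsval _]linear0 subr0.
apply: val_inj; rewrite /= quo_piE.
have := daddv_pi_add (capv_diff V U) (subvP (addvSr C U) _ xU).
rewrite [X in _ + X]daddv_pi_id //; last by rewrite capvC capv_diff.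
by move/(canRL (addrK _)); rewrite subrr.
Qed.

Lemma quo_piK y : quo_pi (vsval y) = y.
Proof.
apply: val_inj; rewrite /= quo_piE daddv_pi_id ?capv_diff //; exact: subvsP.
Qed.

Lemma quo_valV (y : subvs_of C) : vsval y \in V.
Proof. exact: (subvP (diffvSl V U)) _ (subvsP y). Qed.

Lemma quo_actE a x : x \in V -> quo_act a (quo_pi x) = quo_pi (act a x).
Proof.
move=> xV; have E y : quo_act a y = quo_pi (act a (vsval y)).
  by rewrite /quo_act comp_lfunE [linfun _ y]lfunE comp_lfunE.
rewrite {}E.
rewrite -[in RHS](subrK (vsval (quo_pi x)) x) (linearD (act a)) (linearD quo_pi) /=.
have /eqP -> : quo_pi (act a (x - vsval (quo_pi x))) == 0; last by rewrite add0r.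
have dU := sU' a (quo_pi_sub xV).
by rewrite quo_pi0 // (subvP UV).
Qed.

Lemma quo_act_ok : ract_ok quo_act.
Proof.
split=> [|a b|c a b]; apply/lfunP => y; rewrite -(quo_piK y).
- by rewrite quo_actE ?quo_valV // (act1E act_ok) id_lfunE.
- by rewrite comp_lfunE !quo_actE ?sV' ?quo_valV // (actM act_ok).
by rewrite add_lfunE scale_lfunE !quo_actE ?quo_valV // (actP act_ok) linearP.
Qed.

Lemma dim_quo_pi W : (W <= V)%VS -> (\dim (quo_pi @: W) + \dim (W :&: U) = \dim W)%N.
Proof.
move=> WV; rewrite -(limg_ker_dim quo_pi W) addnC; congr (\dim _ + _)%N.
apply/vspaceP => x; rewrite !memv_cap memv_ker.
by have [xW|//] := boolP (x \in W); rewrite quo_pi0 // (subvP WV).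
Qed.

(** On W e_i the projection has kernel U e_i, so both dimensions drop by the same amount, which
    cancels in the difference. *)
Lemma quo_tval (R : numDomainType) (theta : 'I_n -> R) W1 W2 :
  stable act W1 -> stable act W2 ->
  (U <= W1)%VS -> (U <= W2)%VS -> (W1 <= V)%VS -> (W2 <= V)%VS ->
  tval e theta quo_act (quo_pi @: W1) (quo_pi @: W2) = tval e theta act W1 W2.
Proof.
have H i W : stable act W -> (U <= W)%VS -> (W <= V)%VS ->
  (\dim (quo_act (e i) @: (quo_pi @: W)) + \dim (act (e i) @: U) =
   \dim (act (e i) @: W))%N.
  move=> sW UW WV.
  have -> : (quo_act (e i) @: (quo_pi @: W) = quo_pi @: (act (e i) @: W))%VS.
    rewrite -!limg_comp; apply: eq_in_limg => x xW.
    by rewrite comp_lfunE [RHS]comp_lfunE quo_actE // (subvP WV).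
  rewrite -(@dim_quo_pi (act (e i) @: W)).
    congr (_ + \dim _)%N; apply/vspaceP => x.
    rewrite memv_cap !(mem_act_idem idem_e act_ok) // andbAC.
    case: (_ == _); rewrite ?andbF // !andbT.
    by have [xU|] := boolP (x \in U); rewrite ?andbF ?andbT // (subvP UW).
  exact: subv_trans (sW _) WV.
move=> s1 s2 U1 U2 V1 V2; apply: eq_bigr => i _; congr (_ * _).
rewrite -(H i W1) // -(H i W2) // !natrD opprD addrACA subrr addr0 //.
Qed.

Lemma quo_stable W : stable act W -> (W <= V)%VS -> stable quo_act (quo_pi @: W)%VS.
Proof.
move=> /stableP sW WV; apply/stableP => a _ /memv_imgP[x xW ->].
by rewrite quo_actE ?(subvP WV) // memv_img // sW.
Qed.

Lemma quo_submodule W' : stable quo_act W' -> exists W : {vspace M},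
  [/\ stable act W, (U <= W)%VS, (W <= V)%VS & (quo_pi @: W)%VS = W'].
Proof.
move=> /stableP sW'; exists (V :&: quo_pi @^-1: W')%VS; split.
- apply/stableP => a x; rewrite !memv_cap -!memv_preim => /andP[xV xW].
  by rewrite sV' // -quo_actE // sW'.
- apply/subvP => x xU; rewrite memv_cap -memv_preim (subvP UV) //.
  by have := xU; rewrite -quo_pi0 ?(subvP UV) // => /eqP ->; rewrite mem0v.
- exact: capvSl.
apply/vspaceP => y; apply/memv_imgP/idP => [[x]|yW].
  by rewrite memv_cap -memv_preim => /andP[_ xW ->].
by exists (vsval y); rewrite ?quo_piK // memv_cap quo_valV -memv_preim quo_piK.
Qed.

Let piV : (quo_pi @: V)%VS = fullv.
Proof.
apply/eqP; rewrite eqEsubv subvf; apply/subvP => y _.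
by apply/memv_imgP; exists (vsval y); rewrite ?quo_valV ?quo_piK.
Qed.

Let piU : (quo_pi @: U)%VS = 0%VS.
Proof.
apply/eqP; rewrite -subv0; apply/subvP => _ /memv_imgP[x xU ->].
by rewrite memv0 quo_pi0 // (subvP UV).
Qed.

Lemma quo_inT (R : numDomainType) (theta : 'I_n -> R) :
  inT e theta act U V <-> inT e theta quo_act 0%VS fullv.
Proof.
split=> [T W' sW' _ _|T W sW UW WV].
  have [W [sW UW WV <-]] := quo_submodule sW'.
  by rewrite -piV quo_tval //; exact: T.
rewrite -quo_tval // piV; apply: T; [exact: quo_stable|exact: sub0v|exact: subvf].
Qed.

Lemma quo_inF (R : numDomainType) (theta : 'I_n -> R) :
  inF e theta act U V <-> inF e theta quo_act 0%VS fullv.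
Proof.
split=> [T W' sW' _ _|T W sW UW WV].
  have [W [sW UW WV <-]] := quo_submodule sW'.
  by rewrite -piU quo_tval //; exact: T.
rewrite -quo_tval // piU; apply: T; [exact: quo_stable|exact: sub0v|exact: subvf].
Qed.

Lemma TF_equiv_subquotient (R : numDomainType) (theta eta : 'I_n -> R) :
  TF_equiv e theta eta ->
  (inT e theta act U V <-> inT e eta act U V) /\
  (inF e theta act U V <-> inF e eta act U V).
Proof.
move=> /(_ _ _ quo_act_ok)[T F].
by rewrite !quo_inT !quo_inF.
Qed.

End Quotient.

(** * Integral weights viewed in a larger ring *)

Section IntegerPoints.
Variables (k : fieldType) (A : falgType k) (n : nat) (e : 'I_n -> A).
Variables (R : numDomainType) (theta : 'I_n -> int).
Variables (M : vectType k) (act : A -> 'End(M)).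

Lemma tval_intr U V : tval e (fun i => (theta i)%:~R : R) act U V =
  (tval e theta act U V)%:~R.
Proof.
rewrite /tval rmorph_sum; apply: eq_bigr => i _.
by rewrite rmorphM rmorphB /= !rmorph_nat.
Qed.

Lemma inT_intr U V : inT e (fun i => (theta i)%:~R : R) act U V <->
  inT e theta act U V.
Proof. by split=> T W sW UW WV; have := T W sW UW WV; rewrite tval_intr ler0z. Qed.

Lemma inF_intr U V : inF e (fun i => (theta i)%:~R : R) act U V <->
  inF e theta act U V.
Proof. by split=> T W sW UW WV; have := T W sW UW WV; rewrite tval_intr lerz0. Qed.

End IntegerPoints.

(** * The cones D_f *)

Section Signs.
Variables (R : realType) (n : nat).

(** The forms vanishing at [x] cut out a rational subspace. Approximating the coordinates of [x] in
    a rational spanning family keeps these forms zero, and a small error preserves the signs of the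
    others. *)
Lemma rat_signs (I : finType) (c : I -> 'I_n -> int) (x : 'I_n -> R) :
  exists y : 'I_n -> rat, forall i,
    (0 <= \sum_j (c i j)%:~R * x j) = (0 <= \sum_j (c i j)%:~R * y j).
Proof.
pose dotx i := \sum_j (c i j)%:~R * x j.
(* The columns are the forms vanishing at [x]; the other forms are replaced by zero columns. *)
pose Z : 'M[rat]_(n, #|I|) :=
  \matrix_(j, i) (if dotx (enum_val i) == 0 then (c (enum_val i) j)%:~R else 0).
pose X : 'rV[R]_n := \row_j x j.
have XZ : X *m map_mx ratr Z = 0.
  apply/rowP => i; rewrite !mxE; under eq_bigr => j _ do rewrite !mxE.
  case: eqP => [d0|_]; last first.
    by rewrite big1 // => j _; rewrite rmorph0 mulr0.
  by rewrite -[RHS]d0; apply: eq_bigr => j _; rewrite ratr_int mulrC.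
have /submxP[w Xw] : (X <= map_mx (@ratr R) (kermx Z))%MS.
  by rewrite map_kermx; apply/sub_kermxP.
pose K := kermx Z.
pose dotK i l : rat := \sum_j (c i j)%:~R * K l j.
have dotxE i : dotx i = \sum_l w 0 l * ratr (dotK i l).
  have xE j : x j = \sum_l w 0 l * ratr (K l j).
    have /rowP/(_ j) := Xw; rewrite !mxE => ->.
    by apply: eq_bigr => l _; rewrite !mxE.
  rewrite /dotx; under eq_bigr => j _ do rewrite xE mulr_sumr.
  rewrite exchange_big; apply: eq_bigr => l _ /=.
  rewrite rmorph_sum mulr_sumr; apply: eq_bigr => j _.
  by rewrite rmorphM /= ratr_int mulrCA.
have [eps eps0 epsP] : exists2 eps : R, 0 < eps & forall i, dotx i != 0 ->
    eps * (\sum_l `|ratr (dotK i l)|) < `|dotx i|.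
  pose B i : R := 1 + \sum_l `|ratr (dotK i l)|.
  have B0 i : 0 < B i by rewrite ltr_pwDl // sumr_ge0.
  (* The default 1 covers the case of no nonvanishing form; the summand 1 in [B] makes it positive
     and the estimate strict. *)
  exists (\big[Num.min/1]_(i | dotx i != 0) (`|dotx i| / B i)).
    apply: (big_ind (fun z : R => 0 < z)) => [|a b a0 b0|i di]; rewrite ?ltr01 ?lt_min ?a0 //.
    by rewrite divr_gt0 // normr_gt0.
  move=> i di; apply: (@le_lt_trans _ _ (`|dotx i| / B i * (\sum_l `|ratr (dotK i l)|))).
    by rewrite ler_wpM2r ?sumr_ge0 //; apply: bigmin_le_cond.
  rewrite -mulrA gtr_pMr ?normr_gt0 // mulrC ltr_pdivrMr // mul1r.
  by rewrite /B ltrDr ltr01.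
have /choice[v vP] : forall l, exists v : rat, `|w 0 l - ratr v| < eps.
  move=> l; have lt_eps : w 0 l - eps < w 0 l + eps.
    by rewrite ltrD2l (lt_trans _ eps0) // oppr_lt0.
  have [v] := rat_in_itvoo lt_eps.
  by rewrite in_itv /= => vI; exists v; rewrite distrC ltr_distl.
exists (fun j => \sum_l v l * K l j) => i; rewrite -/(dotx i).
have -> : \sum_j (c i j)%:~R * (\sum_l v l * K l j) = \sum_l v l * dotK i l.
  under eq_bigr => j _ do rewrite mulr_sumr.
  rewrite exchange_big; apply: eq_bigr => l _ /=.
  by rewrite mulr_sumr; apply: eq_bigr => j _; rewrite mulrCA.
have [d0|di] := eqVneq (dotx i) 0.
  rewrite d0 lexx big1 ?lexx // => l _.
  suff -> : dotK i l = 0 by rewrite mulr0.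
  have /matrixP/(_ l (enum_rank i)) := mulmx_ker Z; rewrite !mxE => <-.
  by apply: eq_bigr => j _; rewrite !mxE enum_rankK d0 eqxx mulrC.
set s := \sum_l v l * _.
have : `|dotx i - ratr s| < `|dotx i|.
  apply: le_lt_trans (epsP i di).
  rewrite dotxE /s rmorph_sum /= -sumrB mulr_sumr.
  apply: (le_trans (ler_norm_sum _ _ _)); apply: ler_sum => l _.
  by rewrite rmorphM /= -mulrBl normrM ler_wpM2r // ltW.
rewrite -(@ler0q R) => H.
have [d0|d0] := ltP (dotx i) 0; last first.
  have dp : 0 < dotx i by rewrite lt_neqAle eq_sym di.
  move: H; rewrite (gtr0_norm dp) ltr_distlC subrr => /andP[H _].
  by rewrite (ltW H).
move: H; rewrite (ltr0_norm d0) ltr_distlC subrr => /andP[_ H].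
by rewrite leNgt H.
Qed.

(** Scaling by the positive product of all denominators preserves the signs. *)
Lemma int_signs (I : finType) (c : I -> 'I_n -> int) (x : 'I_n -> R) :
  exists y : 'I_n -> int, forall i,
    (0 <= \sum_j (c i j)%:~R * x j) = (0 <= \sum_j c i j * y j).
Proof.
have [y yP] := rat_signs c x.
pose d := \prod_j denq (y j).
have d0 : 0 < d by apply: prodr_gt0 => j _; exact: denq_gt0.
exists (fun j => numq (y j) * \prod_(l | l != j) denq (y l)) => i.
rewrite yP -[RHS](ler0z rat) rmorph_sum /=.
rewrite -(pmulr_rge0 _ (_ : 0 < d%:~R :> rat)) ?ltr0z //.
congr (0 <= _); rewrite mulr_sumr; apply: eq_bigr => j _.
rewrite !rmorphM /= /d (bigD1 j) //= rmorphM /= mulrCA; congr (_ * _).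
by rewrite numqE -[RHS]mulrA [RHS]mulrC.
Qed.

Definition same_signs (N : nat) (x : 'I_n -> R) (y : 'I_n -> int) :=
  forall c : 'I_n -> int, (forall i, `|c i| <= N%:Z) ->
    (0 <= \sum_i (c i)%:~R * x i) = (0 <= \sum_i (c i)%:~R * y i).

(** The shift makes a finite type enumerate the integral vectors with entries between -N and N. *)
Definition box_vector (N : nat) (b : {ffun 'I_n -> 'I_(N.*2.+1)}) (i : 'I_n) : int :=
  (b i)%:Z - N%:Z.

Lemma box_vectorP N (c : 'I_n -> int) : (forall i, `|c i| <= N%:Z) ->
  exists b, box_vector (N := N) b =1 c.
Proof.
move=> cN; exists [ffun i => inord (absz (c i + N%:Z))] => i.
have H := cN i; rewrite /box_vector ffunE inordK; first lia.
lia.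
Qed.

Lemma same_signs_ex N x : exists y, same_signs N x y.
Proof.
have [y yP] := int_signs (@box_vector N) x.
exists y => c /box_vectorP[b bc].
have -> : \sum_i (c i)%:~R * x i = \sum_i (box_vector b i)%:~R * x i.
  by apply: eq_bigr => i _; rewrite bc.
by rewrite yP; congr (0 <= _); apply: eq_bigr => i _; rewrite bc intz.
Qed.

End Signs.

Section Cones.
Variables (k : fieldType) (A : falgType k) (n : nat) (e : 'I_n -> A).

(* Bounds the dimension vectors of all submodules of P(t) and of nu P(s). *)
Definition size_bound (t s : seq 'I_n) : nat :=
  maxn (\dim (fullv : {vspace {ffun 'I_(size t) -> A}}))
       (\dim (fullv : {vspace nuP e s})).

Lemma dim_diff_bound (M : vectType k) (U V : {vspace M}) N :
  (\dim (fullv : {vspace M}) <= N)%N ->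
  `|(\dim V)%:Z - (\dim U)%:Z| <= N%:Z.
Proof.
have := dimvS (subvf U); have := dimvS (subvf V).
by move: (\dim U) (\dim V) (\dim fullv) => a b c; lia.
Qed.

Lemma tval_form (R : numDomainType) (M : vectType k) (act : A -> 'End(M))
    (theta : 'I_n -> R) U V : tval e theta act U V =
  \sum_i ((\dim (act (e i) @: V))%:Z - (\dim (act (e i) @: U))%:Z)%:~R * theta i.
Proof. by apply: eq_bigr => i _; rewrite mulrC intrB -!pmulrn. Qed.

Lemma tvalN (R : numDomainType) (M : vectType k) (act : A -> 'End(M))
    (theta : 'I_n -> R) U V : - tval e theta act U V = tval e theta act V U.
Proof. by rewrite /tval -sumrN; apply: eq_bigr => i _; rewrite -mulrN opprB. Qed.

Lemma inDf_signs (R : realType) t s (f : mx A (size t) (size s)) N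
    (x : 'I_n -> R) (y : 'I_n -> int) :
  (size_bound t s <= N)%N -> same_signs N x y ->
  inDf e f x <-> inDf e f y.
Proof.
rewrite geq_max => /andP[tN sN] xy.
have E (M : vectType k) (act : A -> 'End(M)) U V :
    (\dim (fullv : {vspace M}) <= N)%N ->
    (0 <= tval e x act U V) = (0 <= tval e y act U V) /\
    (tval e x act U V <= 0) = (tval e y act U V <= 0).
  move=> MN; split; first by rewrite !tval_form xy // => i; exact: dim_diff_bound.
  rewrite -oppr_ge0 -[RHS]oppr_ge0 !tvalN !tval_form xy // => i.
  exact: dim_diff_bound.
split=> -[T F]; split=> W sW UW WV.
- by rewrite -(E _ _ _ _ tN).1; exact: T.
- by rewrite -(E _ _ _ _ sN).2; exact: F.
- by rewrite (E _ _ _ _ tN).1; exact: T.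
by rewrite (E _ _ _ _ sN).2; exact: F.
Qed.

(** There may be infinitely many submodules, but their inequalities involve only dimension
    differences, which lie in a finite box. The set [S] is chosen before [R], so it serves real and
    integral points at once. *)
Lemma inDf_box t s (f : mx A (size t) (size s)) N : (size_bound t s <= N)%N ->
  exists S : {set {ffun 'I_n -> 'I_(N.*2.+1)}},
  forall (R : numDomainType) (theta : 'I_n -> R), inDf e f theta <->
    {in S, forall b, 0 <= \sum_i (box_vector b i)%:~R * theta i}.
Proof.
rewrite geq_max => /andP[tN sN].
pose dimdiff (M : vectType k) (act : A -> 'End(M)) (U V : {vspace M}) i :=
  (\dim (act (e i) @: V))%:Z - (\dim (act (e i) @: U))%:Z.
pose quo b := exists W, [/\ stable (@ractv k A (size t)) W, (Imf e f <= W)%VS,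
  (W <= Pspace e t)%VS & box_vector b =1 dimdiff _ (@ractv k A (size t)) W (Pspace e t)].
pose sub b := exists W, [/\ stable (@nuact k A n e s) W,
  (W <= Knuf e f)%VS & box_vector b =1 dimdiff _ (@nuact k A n e s) W 0%VS].
exists [set b | `[< @quo N b \/ @sub N b >]] => R theta; split=> [[T F] b|H].
  rewrite inE => /asboolP[[W [sW UW WV bE]]|[W [sW WV bE]]].
    have := T W sW UW WV; rewrite tval_form; congr (0 <= _).
    by apply: eq_bigr => i _; rewrite bE.
  have := F W sW (sub0v _) WV; rewrite -oppr_ge0 tvalN tval_form; congr (0 <= _).
  by apply: eq_bigr => i _; rewrite bE.
split=> W sW UW WV.
  have [b bE] := box_vectorP (fun i => dim_diff_bound (@ractv k A (size t) (e i) @: W)%VS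
    (@ractv k A (size t) (e i) @: Pspace e t)%VS tN).
  have -> : tval e theta (@ractv k A (size t)) W (Pspace e t) =
      \sum_i (box_vector b i)%:~R * theta i.
    by rewrite tval_form; apply: eq_bigr => i _; rewrite bE.
  by apply: H; rewrite inE; apply/asboolP; left; exists W.
have [b bE] := box_vectorP (fun i => dim_diff_bound (@nuact k A n e s (e i) @: W)%VS
  (@nuact k A n e s (e i) @: 0)%VS sN).
rewrite -oppr_ge0 tvalN.
have -> : tval e theta (@nuact k A n e s) W 0%VS =
    \sum_i (box_vector b i)%:~R * theta i.
  by rewrite tval_form; apply: eq_bigr => i _; rewrite bE.
by apply: H; rewrite inE; apply/asboolP; right; exists W.
Qed.

Lemma inDf_rational (R : numDomainType) t s (f : mx A (size t) (size s)) :
  rational_polyhedral_cone (R := R) (inDf e f).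
Proof.
have [S SP] := inDf_box f (leqnn (size_bound t s)).
exists [seq box_vector b | b <- enum S] => theta; rewrite SP all_map.
split=> [H|/allP H b bS]; last by apply: H; rewrite mem_enum.
by apply/allP => b /=; rewrite mem_enum; exact: H.
Qed.

End Cones.

(* Only finitely many cones D_f occur, so the open sets obtained for the
   individual integer points can be intersected. *)
Lemma general_inDf (k : closedFieldType) (A : falgType k) (n : nat) (e : 'I_n -> A)
    t s (P : ('I_n -> int) -> Prop) :
  (forall theta, P theta ->
     general (@homm _ _ _ e t s) (fun f => inDf e f theta)) ->
  general (@homm _ _ _ e t s) (fun f => forall theta, P theta -> inDf e f theta).
Proof.
move=> gP; pose N := size_bound e t s.
have h0 : homm e (0 : mx A (size t) (size s)).
  by move=> i j; rewrite ffunE mulr0 mul0r.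
pose cone (S : {set {ffun 'I_n -> 'I_(N.*2.+1)}}) (theta : 'I_n -> int) :=
  {in S, forall b, 0 <= \sum_i (box_vector b i)%:~R * theta i}.
have : general (@homm _ _ _ e t s) (fun f => forall S,
    (forall theta, inDf e f theta <-> cone S theta) ->
    forall theta, P theta -> inDf e f theta).
  apply: (general_forall (@homm_linear _ _ _ e t s)); first by exists 0.
  move=> S.
  (* Either the cone of [S] already contains every point of [P], or it misses some [theta]; in the
     latter case no [f] in the open set for [theta] has [S] as its cone. *)
  have [PS|/existsNP[theta /not_implyP[Pt nS]]] := pselect (forall theta, P theta -> cone S theta).
    apply: (general_intro (polyfun_const _ 1) h0) => [|f hf _ fS theta Pt].
      exact: oner_neq0.
    by apply/fS/PS.
  by apply: general_sub (gP _ Pt) => f hf Df fS; case: nS; apply/fS.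
apply: general_sub => f hf H theta Pt.
by have [S SP] := inDf_box f (leqnn N); apply: (H S) => // theta'; exact: SP.
Qed.

(** * Reciprocity between points and presentations for E-tame algebras *)

Section Main.
Variables (k : closedFieldType) (A : falgType k) (n : nat) (e : 'I_n -> A).
Hypothesis idem_e : forall i, e i * e i = e i.
Hypothesis HE : Etame e.

Local Notation Hom eta := (@homm _ _ _ e (summ0 eta) (summ1 eta)).

Lemma inDf_nullhom t s (h : mx A (size t) (size s)) (theta : 'I_n -> int) :
  homm e h -> inDf e h theta ->
  exists g, [/\ Hom theta g, nullhom e g h & nullhom e h g].
Proof.
move=> hh [T F]; have [f0 [g0 [hf0 hg0 fg0]]] := HE theta.
have okR := @ractv_ok k A (size t).
have okN := nuact_ok idem_e s.
have sI := Imf_stable idem_e h; have sP := Pspace_stable idem_e t.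
have IP := Imf_Pspace idem_e hh.
have s0 := @stable0 k A _ (@nuact k A n e s); have sK := Knuf_stable idem_e hh.
have [g1 hg1 G1] := inT_ext0 idem_e okR hf0 hg0 fg0 sI sP IP T.
have [g2 hg2 G2] := inF_hom0 idem_e okN hf0 hg0 fg0 s0 sK (sub0v _) F.
(* The cokernel condition and the kernel condition have their own witnesses; both are open, so one
   [g] satisfies both. *)
have [g hg [E1 E2]] := general_ex (general_and (@homm_linear _ _ _ e _ _)
  (ext0_general idem_e okR hg1 sI sP IP G1)
  (hom0_general idem_e okN hg2 s0 sK (sub0v _) G2)).
by exists g; split=> //; [apply/nullhom_ext0|apply/nullhom_hom0].
Qed.

Lemma nullhom_inDf t s (h : mx A (size t) (size s)) (theta : 'I_n -> int) g :
  homm e h -> Hom theta g -> nullhom e g h -> nullhom e h g -> inDf e h theta.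
Proof.
move=> hh hg /(nullhom_ext0 idem_e hg hh) gh /(nullhom_hom0 idem_e hh hg) hg0.
split.
  apply: (ext0_inT idem_e (@ractv_ok k A _) hg _ _ gh).
    exact: Imf_stable.
  exact: Pspace_stable.
apply: (hom0_inF idem_e (nuact_ok idem_e s) hg _ _ hg0); first exact: stable0.
exact: Knuf_stable.
Qed.

(** With [g] fixed, E(g, h) = 0 is read on K_{nu g} and E(h, g) = 0 on C_g. The modules then no
    longer depend on [h], and both conditions are open in [h]. *)
Lemma inDf_general t s (h : mx A (size t) (size s)) (theta : 'I_n -> int) :
  homm e h -> inDf e h theta ->
  general (@homm _ _ _ e t s) (fun f => inDf e f theta).
Proof.
move=> hh /(inDf_nullhom hh)[g [hg gh hg']].
have sK := Knuf_stable idem_e hg.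
have sI := Imf_stable idem_e g; have sP := Pspace_stable idem_e (summ0 theta).
have IP := Imf_Pspace idem_e hg.
have := general_and (@homm_linear _ _ _ e t s)
  (hom0_general idem_e (nuact_ok idem_e _) hh (@stable0 _ _ _ _) sK (sub0v _)
     ((nullhom_hom0 idem_e hg hh).1 gh))
  (ext0_general idem_e (@ractv_ok k A _) hh sI sP IP
     ((nullhom_ext0 idem_e hh hg).1 hg')).
apply: general_sub => f hf [H1 H2].
by apply: (nullhom_inDf hf hg); [apply/nullhom_hom0|apply/nullhom_ext0].
Qed.

Lemma TF_equiv_inDf (R : numDomainType) t s (h : mx A (size t) (size s))
    (theta eta : 'I_n -> int) :
  TF_equiv e (fun i => (theta i)%:~R : R) (fun i => (eta i)%:~R : R) ->
  homm e h -> inDf e h theta -> inDf e h eta.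
Proof.
move=> TF hh [T F].
have sI := Imf_stable idem_e h; have sP := Pspace_stable idem_e t.
have sK := Knuf_stable idem_e hh; have s0 := @stable0 k A _ (@nuact k A n e s).
have [TT _] := TF_equiv_subquotient idem_e (@ractv_ok k A _) sI sP (Imf_Pspace idem_e hh) TF.
have [_ FF] := TF_equiv_subquotient idem_e (nuact_ok idem_e s) s0 sK (sub0v _) TF.
by split; [apply/(inT_intr e R)/TT/inT_intr|apply/(inF_intr e R)/FF/inF_intr].
Qed.

Lemma inDeta_general (eta : 'I_n -> int) :
  general (Hom eta) (fun f => forall theta : 'I_n -> int,
     inDeta e eta theta -> inDf e f theta).
Proof.
by apply: general_inDf => theta [h [hh hD]]; exact: inDf_general hD.
Qed.

Variable R : realType.

Lemma inDeta_int (eta : 'I_n -> int) N (x : 'I_n -> R) (y : 'I_n -> int) :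
  (size_bound e (summ0 eta) (summ1 eta) <= N)%N -> same_signs N x y ->
  inDeta e eta x <-> inDeta e eta y.
Proof.
by move=> eN xy; split=> -[h [hh hD]]; exists h; split=> //;
  apply/(inDf_signs _ eN xy).
Qed.

Lemma TF_equiv_inDeta (theta eta : 'I_n -> int) (x : 'I_n -> R) :
  TF_equiv e (fun i => (theta i)%:~R : R) (fun i => (eta i)%:~R : R) ->
  inDeta e theta x -> inDeta e eta x.
Proof.
(* The maximum lets a single integral point replace [x] for both [theta] and [eta]. *)
move=> TF; pose N := maxn (size_bound e (summ0 theta) (summ1 theta))
  (size_bound e (summ0 eta) (summ1 eta)).
have [y xy] := same_signs_ex N x.
rewrite (inDeta_int (leq_maxl _ _ : _ <= N)%N xy).
rewrite (inDeta_int (leq_maxr _ _ : _ <= N)%N xy) => -[h [hh hD]].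
have [u [hu uh hu']] := inDf_nullhom hh hD.
(* By symmetry of the two vanishing conditions, [theta] lies in D_u, where [u] presents [y]. TF
   equivalence puts [eta] in D_u, and reciprocity then yields a presentation of [eta] whose cone
   contains [y]. *)
have uD := TF_equiv_inDf TF hu (nullhom_inDf hu hh hu' uh).
have [g [hg gu ug]] := inDf_nullhom hu uD.
by exists g; split=> //; exact: nullhom_inDf ug gu.
Qed.

End Main.

Theorem theorem6p14 (k : closedFieldType) (A : falgType k) (R : realType)
  (n : nat) (e : 'I_n -> A) (He : basic_idempotents e) (HE : Etame e)
  (eta : 'I_n -> int) :
  (* (a) *)
  (general (@homm _ _ _ e (summ0 eta) (summ1 eta))
     (fun f => forall theta : 'I_n -> R, inDf e f theta <-> inDeta e eta theta)
   /\ rational_polyhedral_cone (inDeta (R := R) e eta))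
  /\
  (* (b) *)
  (forall theta : 'I_n -> int,
     TF_equiv e (fun i => (theta i)%:~R : R) (fun i => (eta i)%:~R : R) ->
     forall x : 'I_n -> R, inDeta e theta x <-> inDeta e eta x).
Proof.
have idem_e i : e i * e i = e i by case: He => /(_ i)[].
have gen : general (@homm _ _ _ e (summ0 eta) (summ1 eta))
    (fun f => forall theta : 'I_n -> R, inDf e f theta <-> inDeta e eta theta).
  apply: general_sub (inDeta_general idem_e HE eta) => f hf fD x.
  split=> [xf|]; first by exists f.
  (* Both memberships depend only on signs of integral forms with bounded coefficients, so [x] may
     be replaced by an integral point. *)
  have [y xy] := same_signs_ex (size_bound e (summ0 eta) (summ1 eta)) x.
  by rewrite (inDeta_int (leqnn _) xy) (inDf_signs _ (leqnn _) xy); exact: fD.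
split; first split=> //.
  (* The union D_eta equals a single cone D_f, hence is rational polyhedral. *)
  have [f hf fD] := general_ex gen; have [cs csP] := inDf_rational e R f.
  by exists cs => x; rewrite -fD.
move=> theta TF x; split; apply: TF_equiv_inDeta => // M act ok.
by have [T F] := TF M act ok; split; apply: iff_sym.
Qed.
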